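(* Let $d=n-1$, fix a value of $\varepsilon$, and let $K:\mathbb{T}^{d-1}\times\mathbb{T}^\ell\to U$ be a parameterization of an invariant torus for $H=H_\varepsilon$: $$\phi_{T,\varepsilon}\big(K(\theta,\varphi),\varphi\big)=K(\bar\theta,\bar\varphi)\qquad\text{for all }(\theta,\varphi)\in\mathbb{T}^{d-1}\times\mathbb{T}^\ell,$$ where $\bar\theta=\theta+\omega$, $\bar\varphi=\varphi+\alpha$. Define $\mathcal{X}_H(\theta,\varphi):=X_{H_\varepsilon}\big(K(\theta,\varphi),\varphi\big)-\mathrm{D}_\varphi K(\theta,\varphi)\hat\alpha$ and $$\eta^{31}(\theta,\varphi):=-\mathrm{D}_\theta K(\bar\theta,\bar\varphi)^\top\Omega\big(K(\bar\theta,\bar\varphi)\big)\,\partial_\varepsilon\phi_{T,\varepsilon}\big(K(\theta,\varphi),\varphi\big),$$ $$\eta^{32}(\theta,\varphi):=-\mathcal{X}_H(\bar\theta,\bar\varphi)^\top\Omega\big(K(\bar\theta,\bar\varphi)\big)\,\partial_\varepsilon\phi_{T,\varepsilon}\big(K(\theta,\varphi),\varphi\big).$$ Then the averages of $\eta^{31}$ and $\eta^{32}$ are zero: $\langle\eta^{31}\rangle=0$ and $\langle\eta^{32}\rangle=0$.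
   Context: All maps are assumed sufficiently smooth. $\mathbb{T}^m=\mathbb{R}^m/\mathbb{Z}^m$; $U\subset\mathbb{R}^{2n}$ is open. $\mathrm{D}$, $\mathrm{D}_z$, $\mathrm{D}_\theta$, $\mathrm{D}_\varphi$ denote (partial) Jacobian matrices, so the derivative of a scalar function is a row vector; $\mathrm{D}_\theta K(\bar\theta,\bar\varphi)$ is the Jacobian of $K$ evaluated at $(\bar\theta,\bar\varphi)$. $a:U\to\mathbb{R}^{2n}$ is a smooth map such that $\Omega(z):=\mathrm{D}a(z)^\top-\mathrm{D}a(z)$ is invertible for every $z\in U$ ($\Omega$ represents an exact symplectic form on $U$, independent of $\varepsilon$ and $\varphi$). $\hat\alpha\in\mathbb{R}^\ell$ is fixed, $H_\varepsilon:U\times\mathbb{T}^\ell\to\mathbb{R}$ is a family of Hamiltonians depending analytically on the parameter $\varepsilon\in\mathbb{R}$, $X_{H_\varepsilon}(z,\varphi):=\Omega(z)^{-1}\mathrm{D}_zH_\varepsilon(z,\varphi)^\top$, and $\phi_{t,\varepsilon}(z,\varphi)\in U$ is the solution of $\frac{d}{dt}\phi_{t,\varepsilon}(z,\varphi)=X_{H_\varepsilon}\big(\phi_{t,\varepsilon}(z,\varphi),\varphi+\hat\alpha t\big)$, $\phi_{0,\varepsilon}(z,\varphi)=z$, on its maximal interval of existence. $T>0$ is fixed (independent of $\varepsilon$), $\omega\in\mathbb{R}^{d-1}$, $\alpha:=T\hat\alpha\in\mathbb{R}^\ell$, and $\phi_{T,\varepsilon}$ is assumed to be defined at all points $(K(\theta,\varphi),\varphi)$.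 $\partial_\varepsilon\phi_{T,\varepsilon}\big(K(\theta,\varphi),\varphi\big)$ denotes the partial derivative of $\varepsilon\mapsto\phi_{T,\varepsilon}(z,\varphi)$ with $z$ and $\varphi$ held fixed, evaluated at $z=K(\theta,\varphi)$. $\langle\zeta\rangle:=\int_{\mathbb{T}^{d-1}}\int_{\mathbb{T}^\ell}\zeta(\theta,\varphi)\,d\varphi\,d\theta$ denotes the average (componentwise for vector-valued functions). *)

(* Defs.v *)
From HB Require Import structures.
From mathcomp Require Import all_boot all_order all_algebra.
From mathcomp Require Import all_classical all_reals all_analysis.

Set Implicit Arguments.
Unset Strict Implicit.
Unset Printing Implicit Defensive.

Import Order.TTheory GRing.Theory Num.Theory.
Import numFieldNormedType.Exports.

Local Open Scope classical_set_scope.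
Local Open Scope ring_scope.

(* Points of R^m are column vectors, so that Jacobian matrices act on the left
   ([jacobian] of the library is for row vectors, hence transposed). *)
Definition jac {R : realType} {m n : nat} (f : 'cV[R]_n -> 'cV[R]_m)
    (x : 'cV[R]_n) : 'M[R]_(m, n) :=
  \matrix_(i, j) ('D_(delta_mx j 0) f x) i 0.

Definition jac_scalar {R : realType} {n : nat} (f : 'cV[R]_n -> R)
    (x : 'cV[R]_n) : 'rV[R]_n :=
  \row_j 'D_(delta_mx j 0) f x.

(* For finite-dimensional V, the (k-1)-fold continuous differentiability of
   x |-> 'd f x is that of all the directional derivatives 'D_v f. *)
Fixpoint Ck_at {R : realType} {V W : normedModType R} (k : nat) (A : set V)
    (f : V -> W) : Prop :=
  if k is k'.+1 then
    (forall x, A x -> differentiable f x) /\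
    (forall v, Ck_at k' A (fun x => 'D_v f x))
  else forall x, A x -> {for x, continuous f}.

Definition Ck_on {R : realType} {V W : normedModType R} (k : nat) (A : set V)
    (f : V -> W) : Prop := open A /\ Ck_at k A f.

Definition analytic {R : realType} (f : R -> R) : Prop :=
  forall x0 : R, exists c : R^nat,
    \forall x \near x0, series (fun k => c k * (x - x0) ^+ k) @ \oo --> f x.

(* Functions on the torus T^m = R^m / Z^m are Z^m-periodic functions on R^m. *)
Definition Zperiodic {R : realType} {m : nat} {W : Type} (f : 'cV[R]_m -> W)
    : Prop :=
  forall (x : 'cV[R]_m) (k : 'cV[int]_m), f (x + map_mx intr k) = f x.

(* Integral over T^m, i.e. over the fundamental domain [0, 1]^m, as an iterated
   Lebesgue integral. *)
Fixpoint torus_integral {R : realType} (m : nat) : ('cV[R]_m -> R) -> R :=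
  match m return ('cV[R]_m -> R) -> R with
  | 0 => fun f => f 0
  | m'.+1 => fun f =>
      \int[lebesgue_measure]_(x in `[0, 1])
        @torus_integral R m' (fun v => f (col_mx (x%:M : 'cV[R]_1) v))
  end.

Definition average {R : realType} {m l p : nat}
    (zeta : 'cV[R]_m -> 'cV[R]_l -> 'cV[R]_p) : 'cV[R]_p :=
  \col_i torus_integral (fun theta =>
           torus_integral (fun ph => zeta theta ph i 0)).

Definition is_solution {R : realType} {V : normedModType R} (U : set V)
    (F : R -> V -> V) (z : V) (J : set R) (y : R -> V) : Prop :=
  [/\ open J, is_interval J, J 0, y 0 = z &
      forall t, J t -> U (y t) /\ is_derive t 1 y (F t (y t))].

(* "The solution on its maximal interval of existence J": every other solution
   of the same initial value problem is a restriction of it. *)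
Definition is_maximal_solution {R : realType} {V : normedModType R} (U : set V)
    (F : R -> V -> V) (z : V) (J : set R) (y : R -> V) : Prop :=
  is_solution U F z J y /\
  forall J' y', is_solution U F z J' y' ->
    forall t, J' t -> J t /\ y' t = y t.

Section Hamiltonian.
Context {R : realType} {N l : nat}.
Implicit Types (a : 'cV[R]_N -> 'cV[R]_N)
  (H : R -> 'cV[R]_N -> 'cV[R]_l -> R) (alphahat ph : 'cV[R]_l)
  (z : 'cV[R]_N) (eps t : R).

Definition Omega a z : 'M[R]_N := (jac a z)^T - jac a z.

Definition hamiltonian_field a H eps z ph : 'cV[R]_N :=
  invmx (Omega a z) *m (jac_scalar (fun z' => H eps z' ph) z)^T.

(* [phi t eps z ph] is only meaningful for [dom (t, eps, z, ph)]; outside of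
   [dom] its values are arbitrary. *)
Definition is_flow (U : set 'cV[R]_N) a H alphahat
    (dom : set (R * R * 'cV[R]_N * 'cV[R]_l))
    (phi : R -> R -> 'cV[R]_N -> 'cV[R]_l -> 'cV[R]_N) : Prop :=
  (forall t eps z ph, dom (t, eps, z, ph) -> U z) /\
  (forall eps z ph, U z ->
     is_maximal_solution U
       (fun t y => hamiltonian_field a H eps y (ph + t *: alphahat))
       z [set t | dom (t, eps, z, ph)] (fun t => phi t eps z ph)).

Section Torus.
Context {m : nat}.
Implicit Types (K : 'cV[R]_m -> 'cV[R]_l -> 'cV[R]_N)
  (theta omega : 'cV[R]_m)
  (phi : R -> R -> 'cV[R]_N -> 'cV[R]_l -> 'cV[R]_N) (T : R).

Definition torus_field a H eps alphahat K theta ph : 'cV[R]_N :=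
  hamiltonian_field a H eps (K theta ph) ph - jac (K theta) ph *m alphahat.

Definition deps phi T eps z ph : 'cV[R]_N := derive1 (fun e => phi T e z ph) eps.

Definition eta31 a phi T eps omega alphahat K theta ph : 'cV[R]_m :=
  let thetabar := theta + omega in
  let phbar := ph + T *: alphahat in
  - ((jac (fun th => K th phbar) thetabar)^T *m Omega a (K thetabar phbar)
     *m deps phi T eps (K theta ph) ph).

Definition eta32 a H phi T eps omega alphahat K theta ph : 'cV[R]_1 :=
  let thetabar := theta + omega in
  let phbar := ph + T *: alphahat in
  - ((torus_field a H eps alphahat K thetabar phbar)^T
     *m Omega a (K thetabar phbar)
     *m deps phi T eps (K theta ph) ph).

End Torus.
End Hamiltonian.

(* Main.v *)
Require Import Defs.
From HB Require Import structures.
From mathcomp Require Import all_boot all_order all_algebra.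
From mathcomp Require Import all_classical all_reals all_analysis.
From mathcomp Require Import ring lra.
Import Order.TTheory GRing.Theory Num.Theory.
Import numFieldNormedType.Exports.
Local Open Scope classical_set_scope.
Local Open Scope ring_scope.

Set Implicit Arguments.
Unset Strict Implicit.
Unset Printing Implicit Defensive.

(** Write Omega(xi, eta) = xi^T Omega eta and let z(t) be the orbit issued from
    the point K(theta, phi) of the torus, with phase phi + t alphahat.  Two
    vectors are transported along it: the response v, the derivative of the flow
    with respect to epsilon at a fixed initial condition, with v(0) = 0, and a
    tangent vector w, the derivative of a one-parameter family of orbits of the
    same Hamiltonian with the same phase.  Differentiating the equation of motion
    Omega(z) z' = DH^T in the two directions, and using that Omega is closed and
    that second derivatives commute, gives ([symplectic_rate])

      (d/dt) Omega(w, v) = D_w (d_eps H),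

    an identity in which only the derivative of a scalar function is left on the
    right.

    The family is chosen as s |-> phi_{t + c s}(K(theta + s u, phi - s c alphahat),
    phi - s c alphahat).  The phase seen at time t by its member s is
    phi + t alphahat, whatever s, so that all members solve one nonautonomous
    equation.  The time derivative above is then the derivative at s = 0 of
    E(t + c s, theta + s u, phi - s c alphahat), where E is d_eps H along the
    orbits.  Averaging over the torus absorbs the two translations
    ([mean_dH_translate]): if A(t) is the average of Omega(w, v) and B(t) that
    of E, then A'(t) is the derivative at s = 0 of B(t + c s), that is c B'(t)
    for c = 0 and for c = 1.  Now A(0) = 0 because v(0) = 0, and B(T) = B(0)
    because the time-T map translates the invariant torus; hence A(T) = 0
    ([mean_symplectic_rate]).

    At time T the invariance of the torus turns w into
    c X_H + D K (u, - c alphahat) at the translated point.  For c = 0 and u a basis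
    vector this is a column of D_theta K and A(T) is a component of - <eta31>; for
    c = 1 and u = 0 it is the torus field and A(T) = - <eta32>.

    Since K and the flow are only C^1, the vectors w and v need not be
    differentiable in the angles and the parameter.  Their evolution equation
    ([variational_equation]) comes from a theorem on mixed derivatives that asks
    for the existence and continuity of one of them only ([mixed_derive]).  The
    averages are iterated integrals; linearity, the bound by the supremum and
    invariance under translations suffice to differentiate them with respect to a
    parameter ([mean_derive]), and no integrals need be exchanged. *)

(** * Continuity at a point *)

Section PointwiseContinuity.
Implicit Types A B C D : topologicalType.

Lemma continuous_at_comp A B C (f : A -> B) (g : B -> C) (x : A) :
  {for x, continuous f} -> {for f x, continuous g} ->
  {for x, continuous (fun y => g (f y))}.
Proof. exact: cvg_comp. Qed.

Lemma continuous_at_pair A B C (f : A -> B) (g : A -> C) (x : A) :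
  {for x, continuous f} -> {for x, continuous g} ->
  {for x, continuous (fun y => (f y, g y))}.
Proof. exact: cvg_pair. Qed.

Lemma continuous_at_fst A B C (f : A -> B * C) (x : A) :
  {for x, continuous f} -> {for x, continuous (fun y => (f y).1)}.
Proof. by move=> cf; apply: (continuous_at_comp cf); exact: cvg_fst. Qed.

Lemma continuous_at_snd A B C (f : A -> B * C) (x : A) :
  {for x, continuous f} -> {for x, continuous (fun y => (f y).2)}.
Proof. by move=> cf; apply: (continuous_at_comp cf); exact: cvg_snd. Qed.

Lemma continuous_at_id A (x : A) : {for x, continuous (fun y : A => y)}.
Proof. exact: cvg_id. Qed.

Lemma continuous_at_cst A B (b : B) (x : A) : {for x, continuous (fun=> b)}.
Proof. exact: cvg_cst. Qed.

Lemma continuous_at_comp2 A B C D (f : B -> C -> D) (g : A -> B) (h : A -> C) (x : A) :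
  {for x, continuous g} -> {for x, continuous h} ->
  {for (g x, h x), continuous (fun q => f q.1 q.2)} ->
  {for x, continuous (fun y => f (g y) (h y))}.
Proof.
move=> cg ch cf.
exact: (@continuous_at_comp _ _ _ (fun y => (g y, h y)) _ _ (continuous_at_pair cg ch) cf).
Qed.

End PointwiseContinuity.
Arguments continuous_at_id {A} x.
Arguments continuous_at_cst {A B} b x.

Lemma continuous_section (A B C : topologicalType) (f : A -> B -> C) (a : A) :
  continuous (fun q => f q.1 q.2) -> continuous (f a).
Proof.
move=> cf b; exact: (@continuous_at_comp2 _ _ _ _ f (fun=> a) (fun b => b) b
  (continuous_at_cst a b) (continuous_at_id b) (cf (a, b))).
Qed.

(** * Matrices and mean values *)

Section MatrixContinuity.
Context {R : realType}.

Lemma cV_sum_delta (n : nat) (v : 'cV[R]_n) : v = \sum_(i < n) v i 0 *: delta_mx i 0.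
Proof.
rewrite [LHS]matrix_sum_delta; apply: eq_bigr => i _.
by rewrite big_ord_recl big_ord0 addr0 ord1.
Qed.

Lemma cvg_mx_entries (T : Type) (F : set_system T) {FF : Filter F} (p q : nat)
    (f : T -> 'M[R]_(p, q)) (M : 'M[R]_(p, q)) :
  (forall i j, f x i j @[x --> F] --> M i j) -> f x @[x --> F] --> M.
Proof.
move=> fM A [P MP PA]; rewrite /nbhs/=.
have : \forall x \near F, forall i j, P i j (f x i j).
  apply: filter_forall => i; apply: filter_forall => j.
  exact: fM (MP i j).
by apply: filterS => x Px; apply: PA => i j; exact: Px.
Qed.

Lemma continuous_mx_entries (T : topologicalType) (p q : nat)
    (f : T -> 'M[R]_(p, q)) :
  (forall i j, continuous (fun x => f x i j)) -> continuous f.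
Proof. by move=> fM x; apply: cvg_mx_entries => i j; exact: fM. Qed.

Lemma cV_compact (m : nat) (A : 'I_m -> set R) :
  (forall i, compact (A i)) -> compact [set v : 'cV[R]_m | forall i, A i (v i 0)].
Proof.
move=> cA.
have -> : [set v : 'cV[R]_m | forall i, A i (v i 0)] =
    (fun u : 'rV[R]_m => u^T) @` [set u : 'rV[R]_m | forall i, A i (u 0 i)].
  apply/seteqP; split => [v Av|_ [u Au <-] i]; last by rewrite mxE; exact: Au.
  by exists v^T; rewrite ?trmxK// => i; rewrite mxE; exact: Av.
apply: continuous_compact; last exact: rV_compact.
apply: continuous_subspaceT; apply: continuous_mx_entries => i j.
rewrite (_ : (fun x => _) = (fun u : 'rV[R]_m => u j i)).
  exact: coord_continuous.
by apply/funext => u; rewrite mxE.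
Qed.

End MatrixContinuity.

Section MeanValue.
Context {R : realType}.

(** The sign of the increment is left free, so that one statement serves for
    difference quotients on both sides. *)
Lemma mvt_ball (f df : R -> R) (t0 d h : R) :
  (forall t, `|t - t0| < d -> is_derive t 1 f (df t)) -> `|h| < d ->
  exists2 c, `|c - t0| <= `|h| & f (t0 + h) - f t0 = df c * h.
Proof.
move=> fdf hd.
have ball_lt (a b t : R) : a <= b -> t \in `[a, b] -> `|a - t0| <= `|h| ->
    `|b - t0| <= `|h| -> `|t - t0| <= `|h|.
  move=> ab; rewrite in_itv/= => /andP[at_ tb].
  rewrite !ler_norml => /andP[a1 _] /andP[_ b2].
  by rewrite (le_trans a1) ?lerB// (le_trans _ b2)// lerB.
have mvt (a b : R) : a <= b -> `|a - t0| <= `|h| -> `|b - t0| <= `|h| ->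
    exists2 c, `|c - t0| <= `|h| & f b - f a = df c * (b - a).
  move=> ab ah bh.
  have fab t : t \in `[a, b] -> is_derive t 1 f (df t).
    by move=> tab; apply: fdf; apply: le_lt_trans hd; exact: ball_lt ab tab _ _.
  have fab' t : t \in `]a, b[ -> is_derive t 1 f (df t).
    by move=> tab; apply: fab; exact: subset_itv_oo_cc.
  have cfab : {within `[a, b], continuous f}.
    by apply: derivable_within_continuous => t /fab[].
  have [c cab ->] := MVT_segment ab fab' cfab.
  by exists c => //; exact: ball_lt ab cab _ _.
have [h0|h0] := leP 0 h.
  have [||| c ch E] := mvt t0 (t0 + h).
  - by rewrite lerDl.
  - by rewrite subrr normr0.
  - by rewrite addrAC subrr add0r.
  by exists c => //; rewrite E addrAC subrr add0r.
have [||| c ch E] := mvt (t0 + h) t0.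
- by rewrite gerDl ltW.
- by rewrite addrAC subrr add0r.
- by rewrite subrr normr0.
exists c => //; rewrite -opprB E opprD addrA subrr add0r mulrN opprK//.
Qed.

End MeanValue.

(** * Integration over the unit interval and the torus *)

Section UnitInterval.
Context {R : realType}.
Notation mu := (@lebesgue_measure R).

Lemma integrable01 (f : R -> R) : continuous f ->
  mu.-integrable `[0, 1] (EFin \o f).
Proof.
move=> cf; apply: continuous_compact_integrable; first exact: segment_compact.
exact: continuous_subspaceT.
Qed.

Lemma integral01_comb (c : R) (f g : R -> R) : continuous f -> continuous g ->
  \int[mu]_(x in `[0, 1]) (f x + c * g x) =
  \int[mu]_(x in `[0, 1]) f x + c * \int[mu]_(x in `[0, 1]) g x.
Proof.
move=> cf cg; rewrite RintegralD//; last 2 first.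
- exact: integrable01.
- apply: (@integrable01 (fun x => c * g x)) => x.
  by apply: cvgM; [exact: cvg_cst|exact: cg].
by rewrite RintegralZl//; exact: integrable01.
Qed.

Lemma integral01_norm_le (M : R) (f : R -> R) : continuous f ->
  (forall x, x \in `[0, 1] -> `|f x| <= M) ->
  `|\int[mu]_(x in `[0, 1]) f x| <= M.
Proof.
move=> cf fM; apply: le_trans (le_normr_Rintegral _ _) _ => //.
  exact: integrable01.
have -> : M = \int[mu]_(x in `[0, 1]) M.
  by rewrite Rintegral_cst//= lebesgue_measure_itv/= lte01 EFinN sube0 /= mulr1.
apply: le_Rintegral => //.
- by apply: integrable01 => x; apply: cvg_norm; exact: cf.
- by apply: integrable01 => x; exact: cvg_cst.
Qed.

Lemma integral01_continuous (P : topologicalType) (f : P -> R -> R) :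
  continuous (fun q : P * R => f q.1 q.2) ->
  continuous (fun p => \int[mu]_(x in `[0, 1]) f p x).
Proof.
move=> cf p0; apply/cvgrPdist_le => e e0.
have cfp p : continuous (f p).
  by move=> x; apply: (continuous_section cf).
have : \forall p \near p0, `[0, 1]%classic `<=` (fun x => `|f p0 x - f p x| <= e).
  have := @segment_compact R 0 1 => /compact_near_coveringP; apply => x x01.
  have : (fun q : R * P => f p0 q.1 - f q.2 q.1) @ (nbhs x, nbhs p0) --> (0 : R).
    rewrite -(subrr (f p0 x)); apply: cvgB.
      apply: (@cvg_comp _ _ _ (fun q : R * P => q.1) (f p0)); first exact: cvg_fst.
      exact: cfp.
    apply: (@cvg_comp _ _ _ (fun q : R * P => (q.2, q.1))
      (fun q => f q.1 q.2) _ (nbhs (p0, x))); last exact: (cf (p0, x)).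
    apply: (@cvg_pair _ _ _ _ (nbhs p0) (nbhs x)); first exact: cvg_snd.
    exact: cvg_fst.
  move=> /cvgrPdist_le/(_ _ e0); apply: filterS => q.
  by rewrite /= sub0r normrN.
apply: filterS => p fp.
rewrite -[in X in _ - X](mul1r (\int[mu]_(_ in _) _)) -mulNr -integral01_comb//.
apply: integral01_norm_le => [x|x x01]; last by rewrite mulN1r; exact: fp.
by apply: cvgD; [exact: cfp|apply: cvgM; [exact: cvg_cst|exact: cfp]].
Qed.

End UnitInterval.

Lemma is_derive_translate {R : realType} {W : normedModType R} (f : R -> W) (x c : R) (l : W) :
  is_derive (x + c) 1 f l -> is_derive x 1 (fun y => f (y + c)) l.
Proof.
have E : (fun h : R => h^-1 *: (f (h *: 1 + x + c) - f (x + c))) =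
         (fun h : R => h^-1 *: (f (h *: 1 + (x + c)) - f (x + c))).
  by apply/funext => h; rewrite addrA.
by move=> [df fl]; split; [rewrite /derivable E|rewrite /derive E].
Qed.

Section UnitIntervalTranslation.
Context {R : realType}.
Notation mu := (@lebesgue_measure R).

Lemma periodic_intr (f : R -> R) : (forall x, f (x + 1) = f x) ->
  forall (k : int) x, f (x + k%:~R) = f x.
Proof.
move=> f1; have fn n x : f (x + n%:R) = f x.
  by elim: n x => [|n IH] x; rewrite ?addr0// -addn1 natrD addrA f1 IH.
by case=> n x; rewrite ?fn// NegzE mulrNz -[LHS](fn n.+1) addrNK.
Qed.

(** For a primitive [P] of [f], the left-hand side is [P (1 + c) - P c], whose
    derivative in [c] is [f (1 + c) - f c = 0]. *)
Lemma integral01_translate (f : R -> R) (c : R) : continuous f ->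
  (forall x, f (x + 1) = f x) ->
  \int[mu]_(x in `[0, 1]) f (x + c) = \int[mu]_(x in `[0, 1]) f x.
Proof.
move=> cf f1.
(* Starting the primitive at -1 makes it differentiable at 0 as well. *)
pose P (x : R) : R := \int[mu]_(y in `[-1, x]) f y.
have dP (x : R) : -1 < x -> is_derive x 1 P (f x).
  move=> x1; have [||||dP PE] := @continuous_FTC1_closed R f (-1) x (x + 1).
  - by rewrite ltrDl.
  - apply: continuous_compact_integrable; first exact: segment_compact.
    exact: continuous_subspaceT.
  - by [].
  - exact: cf.
  by apply: (DeriveDef dP); rewrite -derive1E; exact: PE.
have intP (d : R) : -1 < d -> \int[mu]_(x in `[0, 1]) f (x + d) = P (1 + d) - P d.
  move=> d1.
  have dPd (x : R) : 0 <= x -> is_derive x 1 (fun y => P (y + d)) (f (x + d)).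
    move=> x0; apply: is_derive_translate; apply: dP.
    by rewrite (lt_le_trans d1)// lerDr.
  have cPd (x : R) : 0 <= x -> {for x, continuous (fun y => P (y + d))}.
    move=> /dPd[Px _]; apply: differentiable_continuous.
    exact/derivable1_diffP.
  rewrite /Rintegral (@continuous_FTC2 _ _ (fun y => P (y + d)))//=.
  - by rewrite add0r.
  - apply: continuous_subspaceT => x.
    apply: (@cvg_comp _ _ _ (fun x => x + d) f _ (nbhs (x + d))); last exact: cf.
    by apply: cvgD; [exact: cvg_id|exact: cvg_cst].
  - split.
    + by move=> x; rewrite in_itv/= => /andP[/ltW/dPd[]].
    + by apply: cvg_at_right_filter; exact: cPd.
    + by apply: cvg_at_left_filter; exact: cPd.
  - by move=> x; rewrite in_itv/= => /andP[/ltW/dPd[_ Px] _]; rewrite derive1E.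
have trans01 (d : R) : 0 <= d -> \int[mu]_(x in `[0, 1]) f (x + d) = P 1 - P 0.
  move=> d0; rewrite intP ?(lt_le_trans _ d0)// ?oppr_lt0//.
  have dg (x : R) : 0 <= x -> is_derive x 1 (fun y => P (y + 1) - P y) 0.
    move=> x0; rewrite -(subrr (f x)) -{1}f1; apply: is_deriveB.
      by apply: is_derive_translate; apply: dP; rewrite (@lt_le_trans _ _ 0)// ?oppr_lt0// addr_ge0.
    by apply: dP; rewrite (@lt_le_trans _ _ 0)// oppr_lt0.
  have dg' x : x \in `]0, d[ -> is_derive x 1 (fun y => P (y + 1) - P y) 0.
    by rewrite in_itv/= => /andP[/ltW/dg].
  have cg : {within `[0, d], continuous (fun y => P (y + 1) - P y)}.
    apply: derivable_within_continuous => x; rewrite in_itv/= => /andP[/dg + _].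
    by case.
  have [x _] := MVT_segment d0 dg' cg.
  by rewrite mul0r add0r => /eqP; rewrite subr_eq0 (addrC d) => /eqP.
have intE (d : R) : 0 <= d -> \int[mu]_(x in `[0, 1]) f (x + d) = \int[mu]_(x in `[0, 1]) f x.
  move=> d0; rewrite trans01// -(@trans01 0)//.
  by under eq_Rintegral do rewrite addr0.
rewrite -[RHS](@intE (c - (Num.floor c)%:~R)) ?subr_ge0 ?floor_le//.
apply: eq_Rintegral => x _; rewrite addrA -[LHS](periodic_intr f1 (- Num.floor c)).
by rewrite mulrNz.
Qed.

End UnitIntervalTranslation.

Section TorusIntegral.
Context {R : realType}.
Notation mu := (@lebesgue_measure R).

Definition cube (m : nat) : set 'cV[R]_m :=
  [set v | forall i, `[0, 1]%classic (v i 0)].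

Lemma cube_compact (m : nat) : compact (@cube m).
Proof. by apply: (@cV_compact _ _ (fun=> `[0, 1]%classic)) => _; exact: segment_compact. Qed.

Lemma cube_col_mx (m : nat) (x : R) (v : 'cV[R]_m) : x \in `[0, 1] -> cube v ->
  @cube (1 + m) (col_mx (x%:M : 'cV[R]_1) v).
Proof.
move=> x01 v01 i; case: (split_ordP i) => k ->; last by rewrite col_mxEd; exact: v01.
by rewrite col_mxEu ord1 mxE eqxx mulr1n.
Qed.

Lemma continuous_col_mx_scalar (m : nat) :
  continuous (fun q : R * 'cV[R]_m => col_mx (q.1%:M : 'cV[R]_1) q.2).
Proof.
apply: continuous_mx_entries => i j.
case: (split_ordP i) => k ->.
  rewrite (_ : (fun q => _) = fst); first by move=> q; exact: cvg_fst.
  by apply/funext => q; rewrite col_mxEu !ord1 mxE eqxx mulr1n.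
rewrite (_ : (fun q => _) = (fun M : 'cV[R]_m => M k j) \o snd); last first.
  by apply/funext => q; rewrite col_mxEd.
by move=> q; apply: cvg_comp; [exact: cvg_snd|exact: coord_continuous].
Qed.

Lemma continuous_col_mx_comp (m : nat) (f : 'cV[R]_m.+1 -> R) : continuous f ->
  continuous (fun q : R * 'cV[R]_m => f (col_mx (q.1%:M : 'cV[R]_1) q.2)).
Proof.
move=> cf q.
exact: (@continuous_at_comp _ _ _ _ f q (@continuous_col_mx_scalar m q) (cf _)).
Qed.

(** The three properties are proved together: in the induction on the dimension,
    linearity and the bound for the outer integral need the inner one to be
    continuous in its parameter. *)
Lemma torus_integral_props (m : nat) :
  [/\ forall (c : R) (f g : 'cV[R]_m -> R), continuous f -> continuous g ->
        torus_integral (fun v => f v + c * g v) =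
        torus_integral f + c * torus_integral g,
      forall (M : R) (f : 'cV[R]_m -> R), continuous f ->
        (forall v, cube v -> `|f v| <= M) -> `|torus_integral f| <= M &
      forall (P : topologicalType) (f : P -> 'cV[R]_m -> R),
        continuous (fun q => f q.1 q.2) ->
        continuous (fun p => torus_integral (f p))].
Proof.
elim: m => [|m [IHcomb IHle IHcts]].
  split => //= [M f _|P f cf p]; first by apply => -[].
  have cst0 : {for p, continuous (fun=> 0 : 'cV[R]_0)} := continuous_at_cst (0 : 'cV[R]_0) p.
  have := @continuous_at_comp2 _ _ _ _ f (fun p => p) _ p (continuous_at_id p) cst0 (cf (p, 0)).
  exact.
have cslice (P : topologicalType) (f : P -> 'cV[R]_m.+1 -> R) :
    continuous (fun q => f q.1 q.2) ->
    continuous (fun q : P * R * 'cV[R]_m => f q.1.1 (col_mx (q.1.2%:M : 'cV[R]_1) q.2)).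
  move=> cf q.
  apply: (@continuous_at_comp2 _ _ _ _ f (fun q : P * R * 'cV[R]_m => q.1.1)
    (fun q => col_mx (q.1.2%:M : 'cV[R]_1) q.2)); last exact: cf.
    by do 2 apply: continuous_at_fst; exact: continuous_at_id.
  apply: (@continuous_at_comp2 _ _ _ _ (fun x v => col_mx (x%:M : 'cV[R]_1) v)
    (fun q : P * R * 'cV[R]_m => q.1.2) (fun q => q.2)); last first.
  - exact: (@continuous_col_mx_scalar m (q.1.2, q.2)).
  - by apply: continuous_at_snd; exact: continuous_at_id.
  - by apply: continuous_at_snd; apply: continuous_at_fst; exact: continuous_at_id.
have cslice2 (f : 'cV[R]_m.+1 -> R) : continuous f -> forall x : R,
    continuous (fun v : 'cV[R]_m => f (col_mx (x%:M : 'cV[R]_1) v)).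
  move=> cf x.
  exact: (@continuous_section _ _ _ (fun x v => f (col_mx (x%:M : 'cV[R]_1) v)) x
    (continuous_col_mx_comp cf)).
have cint (f : 'cV[R]_m.+1 -> R) : continuous f -> continuous (fun x : R =>
    torus_integral (fun v : 'cV[R]_m => f (col_mx (x%:M : 'cV[R]_1) v))).
  by move=> cf; apply: IHcts; exact: continuous_col_mx_comp.
split => /=.
- move=> c f g cf cg; rewrite -integral01_comb; [|exact: cint..].
  by apply: eq_Rintegral => x _; apply: IHcomb; exact: cslice2.
- move=> M f cf fM; apply: integral01_norm_le; first exact: cint.
  move=> x x01; apply: IHle => [|v v01]; first exact: cslice2.
  by apply: fM; exact: cube_col_mx.
- move=> P f cf; apply: (@integral01_continuous _ _ (fun p x =>
    torus_integral (fun v : 'cV[R]_m => f p (col_mx (x%:M : 'cV[R]_1) v)))).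
  exact: (IHcts _ (fun q v => f q.1 (col_mx (q.2%:M : 'cV[R]_1) v)) (cslice _ _ cf)).
Qed.

Lemma torus_integral_translate (m : nat) (f : 'cV[R]_m -> R) (c : 'cV[R]_m) :
  continuous f -> Zperiodic f ->
  torus_integral (fun v => f (v + c)) = torus_integral f.
Proof.
elim: m f c => [|m IH] f c cf fper /=; first by congr f; apply/colP => -[].
pose g x := torus_integral (fun v : 'cV[R]_m => f (col_mx (x%:M : 'cV[R]_1) v)).
have cf2 := continuous_col_mx_comp cf.
have fper2 (x : R) (v : 'cV[R]_m) (k : int) (h : 'cV[int]_m) :
    f (col_mx ((x + k%:~R)%:M : 'cV[R]_1) (v + map_mx intr h)) = f (col_mx (x%:M : 'cV[R]_1) v).
  have -> : col_mx ((x + k%:~R)%:M : 'cV[R]_1) (v + map_mx intr h) =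
      col_mx (x%:M : 'cV[R]_1) v + map_mx intr (col_mx (k%:M : 'cV[int]_1) h).
    rewrite map_col_mx add_col_mx; congr col_mx; apply/matrixP => i j.
    by rewrite !ord1 !mxE eqxx !mulr1n.
  exact: fper.
pose c0 := usubmx (c : 'cV[R]_(1 + m)) 0 0.
transitivity (\int[mu]_(x in `[0, 1]) g (x + c0)).
  apply: eq_Rintegral => x _; rewrite /g.
  rewrite -(IH (fun v : 'cV[R]_m => f (col_mx ((x + c0)%:M : 'cV[R]_1) v)) (dsubmx (c : 'cV[R]_(1 + m)))).
  - congr torus_integral; apply/funext => v.
    congr f; rewrite -[c in LHS](vsubmxK (c : 'cV[R]_(1 + m))).
    rewrite [LHS](@add_col_mx _ 1 m 1).
    apply: (f_equal2 (@col_mx R 1 m 1)) => //; apply/matrixP => i j.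
    by rewrite !ord1 /c0 !mxE eqxx !mulr1n.
  - exact: (@continuous_section _ _ _ (fun x v => f (col_mx (x%:M : 'cV[R]_1) v)) _ cf2).
  - move=> v h; by rewrite -[RHS](fper2 _ _ 0 h) addr0.
apply: (integral01_translate (f := g)).
  by have [_ _] := torus_integral_props m; apply; exact: cf2.
move=> x; congr torus_integral; apply/funext => v.
by rewrite -[RHS](fper2 _ _ 1 0) raddf0 addr0.
Qed.

End TorusIntegral.

(** * Averages over a pair of tori *)

Section Mean.
Context {R : realType} {m l : nat}.
Implicit Types f g : 'cV[R]_m -> 'cV[R]_l -> R.

Definition mean f : R := torus_integral (fun th => torus_integral (f th)).

Let inner_continuous f : continuous (fun q => f q.1 q.2) ->
  continuous (fun th => torus_integral (f th)).
Proof. by move=> cf; have [_ _] := @torus_integral_props R l; apply. Qed.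

Lemma mean_comb (c : R) f g : continuous (fun q => f q.1 q.2) ->
  continuous (fun q => g q.1 q.2) ->
  mean (fun th ph => f th ph + c * g th ph) = mean f + c * mean g.
Proof.
move=> cf cg; have [comb _ _] := @torus_integral_props R m.
rewrite /mean -comb; [|exact: inner_continuous..].
congr torus_integral; apply/funext => th.
have [comb' _ _] := @torus_integral_props R l.
by apply: comb'; exact: continuous_section.
Qed.

Lemma mean_opp f : continuous (fun q => f q.1 q.2) ->
  mean (fun th ph => - f th ph) = - mean f.
Proof.
move=> cf; have -> : - mean f = mean f + (- 2) * mean f by ring.
rewrite -mean_comb//; congr mean; apply/funext => th; apply/funext => ph.
by ring.
Qed.

Lemma mean_norm_le (M : R) f : continuous (fun q => f q.1 q.2) ->
  (forall th ph, cube th -> cube ph -> `|f th ph| <= M) -> `|mean f| <= M.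
Proof.
move=> cf fM; have [_ le _] := @torus_integral_props R m.
apply: le => [|th th01]; first exact: inner_continuous.
have [_ le' _] := @torus_integral_props R l.
by apply: le' => [|ph ph01]; [exact: continuous_section|exact: fM].
Qed.

Lemma mean_translate f (c : 'cV[R]_m) (d : 'cV[R]_l) :
  continuous (fun q => f q.1 q.2) ->
  (forall ph, Zperiodic (fun th => f th ph)) -> (forall th, Zperiodic (f th)) ->
  mean (fun th ph => f (th + c) (ph + d)) = mean f.
Proof.
move=> cf fm fl.
rewrite /mean -[RHS](torus_integral_translate c (inner_continuous cf)).
  congr torus_integral; apply/funext => th.
  by rewrite torus_integral_translate//; exact: continuous_section.
by move=> th k; congr torus_integral; apply/funext => ph; exact: fm.
Qed.

(** The difference quotient of [f] at [t0] is a value of [k] at a nearby time, and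
    by compactness of the cubes [k] varies little, uniformly on the tori. *)
Lemma mean_derive (J : set R) (f k : R -> 'cV[R]_m -> 'cV[R]_l -> R) (t0 : R) :
  open J -> J t0 ->
  (forall t, J t -> continuous (fun q => f t q.1 q.2)) ->
  (forall t th ph, J t ->
     {for (t, (th, ph)), continuous (fun p => k p.1 p.2.1 p.2.2)}) ->
  (forall t th ph, J t -> is_derive t 1 (fun s => f s th ph) (k t th ph)) ->
  is_derive t0 1 (fun s => mean (f s)) (mean (k t0)).
Proof.
move=> oJ Jt0 cf ck fk.
have ckt t : J t -> continuous (fun q => k t q.1 q.2).
  move=> Jt [th ph].
  apply: (@continuous_at_comp2 _ _ _ _ (fun t q => k t q.1 q.2) (fun=> t) (fun q => q)).
  - exact: continuous_at_cst.
  - exact: continuous_at_id.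
  - exact: ck.
have lim : h^-1 *: (mean (f (h *: 1 + t0)) - mean (f t0)) @[h --> 0^'] --> mean (k t0).
  apply/cvgrPdist_le => e e0.
  have near_t0 : \forall t \near t0, (cube (R:=R) (m:=m) `*` cube (R:=R) (m:=l)) `<=`
      (fun q => J t /\ `|k t0 q.1 q.2 - k t q.1 q.2| <= e).
    have cov := (compact_near_coveringP _).1
      (compact_setX (@cube_compact R m) (@cube_compact R l)).
    apply: (cov R (nbhs t0)
      (fun t q => J t /\ `|k t0 q.1 q.2 - k t q.1 q.2| <= e)) => -[th ph] _.
    have kk : (fun q : ('cV[R]_m * 'cV[R]_l) * R => k t0 q.1.1 q.1.2 - k q.2 q.1.1 q.1.2)
        @ (nbhs (th, ph), nbhs t0) --> (0 : R).
      rewrite -(subrr (k t0 th ph)); apply: cvgB.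
        apply: (@cvg_comp _ _ _ (fun q => q.1) (fun q : 'cV[R]_m * 'cV[R]_l => k t0 q.1 q.2)).
          exact: cvg_fst.
        exact: (ckt _ Jt0 (th, ph)).
      apply: (@cvg_comp _ _ _ (fun q : ('cV[R]_m * 'cV[R]_l) * R => (q.2, q.1))
        (fun p => k p.1 p.2.1 p.2.2) _ (nbhs (t0, (th, ph)))).
        apply: (@cvg_pair _ _ _ _ (nbhs t0) (nbhs (th, ph))); first exact: cvg_snd.
        exact: cvg_fst.
      exact: (ck _ _ _ Jt0).
    have JJ : \forall q \near (nbhs (th, ph), nbhs t0), J q.2.
      by apply: cvg_snd; exact: open_nbhs_nbhs.
    move/cvgrPdist_le : kk => /(_ _ e0); apply: filterS2 JJ => q Jq.
    by rewrite /= sub0r normrN.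
  have /nbhs_ballP[d /= d0 dk] := near_t0.
  near=> h.
  have hd : `|h| < d by near: h; exact: dnbhs0_lt.
  have h0 : h != 0 by near: h; exact: nbhs_dnbhs_neq.
  have Jd t : `|t - t0| < d -> J t.
    move=> td; have c0 n : @cube R n 0.
      by move=> i; rewrite /= mxE in_itv/= lexx ler01.
    have /dk/(_ (0, 0)) : ball t0 d t by rewrite /ball/= distrC.
    by case=> //; split; exact: c0.
  have Jh : J (t0 + h) by apply: Jd; rewrite addrAC subrr add0r.
  rewrite [h *: 1]mulr1 [h + _]addrC.
  have E : mean (k t0) - h^-1 *: (mean (f (t0 + h)) - mean (f t0)) =
      mean (fun th ph => k t0 th ph + (- h^-1) * (f (t0 + h) th ph + (- 1) * f t0 th ph)).
    rewrite mean_comb; last 2 first.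
    - exact: ckt.
    - move=> q; apply: cvgD; first exact: (cf _ Jh).
      by apply: cvgM; [exact: cvg_cst|exact: (cf _ Jt0)].
    rewrite mean_comb; [|exact: cf..].
    by rewrite mulN1r mulNr.
  rewrite E; apply: mean_norm_le => [q|th ph th01 ph01].
    apply: cvgD; first exact: (ckt _ Jt0).
    apply: cvgM; first exact: cvg_cst.
    apply: cvgD; first exact: (cf _ Jh).
    by apply: cvgM; [exact: cvg_cst|exact: (cf _ Jt0)].
  have fk' t : `|t - t0| < d -> is_derive t 1 (fun s => f s th ph) (k t th ph).
    by move=> /Jd; exact: fk.
  have [c ch] := mvt_ball fk' hd.
  rewrite mulN1r => ->; rewrite mulNr mulrC mulfK//.
  have /dk/(_ (th, ph)) : ball t0 d c by rewrite /ball/= distrC (le_lt_trans ch).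
  by case.
split; first by apply/cvg_ex; exists (mean (k t0)).
exact: cvg_lim lim.
Unshelve. all: by end_near. Qed.

End Mean.

(** * Continuously differentiable maps *)

Section DirectionalDerivative.
Context {R : realType}.
Implicit Types V W X : normedModType R.

Lemma derive_comp V W X (f : V -> W) (g : W -> X) (x v : V) :
  differentiable f x -> differentiable g (f x) ->
  'D_v (fun y => g (f y)) x = 'D_('D_v f x) g (f x).
Proof.
move=> df dg; rewrite !deriveE//; last exact: (differentiable_comp df dg).
by rewrite (diff_comp df dg).
Qed.

Lemma is_derive_comp V W X (f : V -> W) (g : W -> X) (x v : V) (w : W) :
  is_derive x v f w -> differentiable g (f x) ->
  is_derive x v (fun y => g (f y)) ('D_w g (f x)).
Proof.
move=> [/derivable1P df fw] dg.
have df1 : differentiable (fun h : R => f (h *: v + x)) 0 by apply/derivable1_diffP.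
have E : f (0 *: v + x) = f x by rewrite scale0r add0r.
have dg0 : differentiable g (f (0 *: v + x)) by rewrite E.
split.
  apply/derivable1P; apply/derivable1_diffP.
  exact: (differentiable_comp df1 dg0).
have DE (Y : normedModType R) (h : V -> Y) : 'D_v h x = 'D_1 (fun a : R => h (a *: v + x)) 0.
  rewrite /derive; set q1 := (X in lim (X @ _)); set q2 := (X in _ = lim (X @ _)).
  suff -> : q1 = q2 by [].
  by apply/funext => a; rewrite /q1 /q2 /= addr0 scale0r add0r [a *: 1]mulr1.
by rewrite DE (derive_comp _ df1 dg0) -DE fw E.
Qed.

Lemma deriveDvec V W (f : V -> W) (x v w : V) : differentiable f x ->
  'D_(v + w) f x = 'D_v f x + 'D_w f x.
Proof. by move=> df; rewrite !deriveE// linearD. Qed.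

Lemma deriveZvec V W (f : V -> W) (x v : V) (c : R) : differentiable f x ->
  'D_(c *: v) f x = c *: 'D_v f x.
Proof. by move=> df; rewrite !deriveE// linearZ. Qed.

Lemma derive_sumvec V W (f : V -> W) (x : V) (I : finType) (c : I -> R)
    (e : I -> V) : differentiable f x ->
  'D_(\sum_i c i *: e i) f x = \sum_i c i *: 'D_(e i) f x.
Proof.
move=> df; rewrite deriveE// linear_sum; apply: eq_bigr => i _.
by rewrite linearZ deriveE.
Qed.

Lemma is_derive_fst V W X (f : V -> W * X) (x v : V) d :
  is_derive x v f d -> is_derive x v (fun y => (f y).1) d.1.
Proof.
move=> fx; have cf : continuous (fst : W * X -> W) by move=> q; exact: cvg_fst.
have df : differentiable (fst : W * X -> W) (f x) by exact: linear_differentiable.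
by apply: is_derive_eq (is_derive_comp fx df) _; rewrite deriveE// diff_lin.
Qed.

Lemma is_derive_snd V W X (f : V -> W * X) (x v : V) d :
  is_derive x v f d -> is_derive x v (fun y => (f y).2) d.2.
Proof.
move=> fx; have cf : continuous (snd : W * X -> X) by move=> q; exact: cvg_snd.
have df : differentiable (snd : W * X -> X) (f x) by exact: linear_differentiable.
by apply: is_derive_eq (is_derive_comp fx df) _; rewrite deriveE// diff_lin.
Qed.

Lemma is_derive_pair V W X (f : V -> W) (g : V -> X) (x v : V) df dg :
  is_derive x v f df -> is_derive x v g dg ->
  is_derive x v (fun y => (f y, g y)) (df, dg).
Proof.
move=> [fx <-] [gx <-].
have lim : (fun h : R => h^-1 *: ((f (h *: v + x), g (h *: v + x)) - (f x, g x)))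
    @ 0^' --> ('D_v f x, 'D_v g x).
  exact: (cvg_pair fx gx).
split; first by apply/cvg_ex; exists ('D_v f x, 'D_v g x).
exact: cvg_lim lim.
Qed.

End DirectionalDerivative.

Section ContinuouslyDifferentiable.
Context {R : realType}.
Implicit Types V W X : normedModType R.

(** Continuity is required of the derivative in the point and the direction
    jointly: in this form the class is stable under composition without reference
    to a basis. *)
Definition C1 V W (A : set V) (f : V -> W) :=
  [/\ open A, forall x, A x -> differentiable f x &
      forall x v, A x -> {for (x, v), continuous (fun q => 'D_(q.2) f q.1)}].

Lemma C1_open V W (A : set V) (f : V -> W) : C1 A f -> open A.
Proof. by case. Qed.

Lemma C1_diff V W (A : set V) (f : V -> W) x : C1 A f -> A x -> differentiable f x.
Proof. by case=> _ + _; apply. Qed.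

Lemma C1_continuous V W (A : set V) (f : V -> W) x :
  C1 A f -> A x -> {for x, continuous f}.
Proof. by move=> fA Ax; apply: differentiable_continuous; exact: C1_diff fA Ax. Qed.

Lemma C1_deriveP V W (A : set V) (f : V -> W) x v :
  C1 A f -> A x -> is_derive x v f ('D_v f x).
Proof. by move=> fA Ax; apply: derivableP; apply: diff_derivable; exact: C1_diff fA Ax. Qed.

Lemma C1_derive_continuous V W (A : set V) (f : V -> W) x v :
  C1 A f -> A x -> {for (x, v), continuous (fun q => 'D_(q.2) f q.1)}.
Proof. by case=> _ _; apply. Qed.

Lemma C1_derive_continuous_comp (T : topologicalType) V W (A : set V) (f : V -> W)
    (g d : T -> V) (x : T) : C1 A f -> A (g x) ->
  {for x, continuous g} -> {for x, continuous d} ->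
  {for x, continuous (fun y => 'D_(d y) f (g y))}.
Proof.
move=> fA Agx cg cd.
exact: (@continuous_at_comp2 _ _ _ _ (fun y w => 'D_w f y) g d x cg cd
  (C1_derive_continuous fA Agx)).
Qed.

Lemma C1_derive_dir_continuous V W (A : set V) (f : V -> W) x v : C1 A f -> A x ->
  {for x, continuous (fun y => 'D_v f y)}.
Proof. by move=> fA Ax; exact: (C1_derive_continuous_comp fA Ax (continuous_at_id x) (continuous_at_cst v x)). Qed.

Lemma C1_intro V W (A : set V) (f : V -> W) (df : V -> V -> W) :
  open A -> (forall x, A x -> differentiable f x) ->
  (forall x v, A x -> 'D_v f x = df x v) ->
  (forall x v, A x -> {for (x, v), continuous (fun q => df q.1 q.2)}) -> C1 A f.
Proof.
move=> oA df_ dfE cdf; split => // x v Ax.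
have E : {near (x, v), (fun q => df q.1 q.2) =1 (fun q : V * V => 'D_(q.2) f q.1)}.
  have : \forall q \near (x, v), A q.1 by apply: cvg_fst; exact: open_nbhs_nbhs.
  by apply: filterS => q Aq; rewrite dfE.
rewrite /prop_for /continuous_at /= dfE//.
apply: cvg_trans (cdf x v Ax); exact: near_eq_cvg.
Qed.

Lemma C1_sub V W (A B : set V) (f : V -> W) :
  open B -> B `<=` A -> C1 A f -> C1 B f.
Proof. by move=> oB BA [_ df cf]; split => // [x /BA/df|x v /BA/cf]. Qed.

Lemma C1_cst V W (A : set V) (w : W) : open A -> C1 A (fun=> w).
Proof.
move=> oA; apply: (@C1_intro _ _ _ _ (fun _ _ => 0)) => // [x v _|x v _].
  by rewrite derive_cst.
exact: continuous_at_cst.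
Qed.

Lemma C1_linear V W (A : set V) (f : {linear V -> W}) : open A -> continuous f -> C1 A f.
Proof.
move=> oA cf; apply: (@C1_intro _ _ _ _ (fun _ v => f v)) => // [x _|x v _|x v _].
- exact: linear_differentiable.
- by rewrite deriveE ?diff_lin//; exact: linear_differentiable.
- by apply: continuous_at_comp; [exact: cvg_snd|exact: cf].
Qed.

Lemma C1_comp V W X (A : set V) (B : set W) (f : V -> W) (g : W -> X) :
  C1 A f -> C1 B g -> (forall x, A x -> B (f x)) -> C1 A (fun x => g (f x)).
Proof.
move=> fA gB AB.
apply: (@C1_intro _ _ _ _ (fun x v => 'D_('D_v f x) g (f x))).
- exact: C1_open fA.
- move=> x Ax; apply: differentiable_comp; first exact: C1_diff fA Ax.
  exact: C1_diff gB (AB _ Ax).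
- by move=> x v Ax; exact: (derive_comp v (C1_diff fA Ax) (C1_diff gB (AB _ Ax))).
- move=> x v Ax.
  apply: (@continuous_at_comp2 _ _ _ _ (fun y w => 'D_w g y) (fun q => f q.1) (fun q => 'D_(q.2) f q.1)).
  + by apply: continuous_at_comp; [exact: cvg_fst|exact: C1_continuous fA Ax].
  + exact: C1_derive_continuous fA Ax.
  + exact: C1_derive_continuous gB (AB _ Ax).
Qed.

Lemma C1_pair V W X (A : set V) (f : V -> W) (g : V -> X) :
  C1 A f -> C1 A g -> C1 A (fun x => (f x, g x)).
Proof.
move=> fA gA; apply: (@C1_intro _ _ _ _ (fun x v => ('D_v f x, 'D_v g x))).
- exact: C1_open fA.
- by move=> x Ax; apply: differentiable_pair; [exact: C1_diff fA Ax|exact: C1_diff gA Ax].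
- by move=> x v Ax; have [_ ->] := is_derive_pair (C1_deriveP v fA Ax) (C1_deriveP v gA Ax).
- move=> x v Ax; apply: continuous_at_pair; [exact: C1_derive_continuous fA Ax|exact: C1_derive_continuous gA Ax].
Qed.

Lemma C1_id V (A : set V) : open A -> C1 A (fun x => x).
Proof.
move=> oA; apply: (@C1_intro _ _ _ _ (fun _ v => v)) => // [x v _|x v _].
  by rewrite derive_id.
by apply: continuous_at_snd; exact: continuous_at_id.
Qed.

Lemma C1_fst V W X (A : set V) (f : V -> W * X) : C1 A f -> C1 A (fun x => (f x).1).
Proof.
move=> fA; apply: (@C1_comp _ _ _ _ setT f fst) => //.
by apply: C1_linear; [exact: openT|move=> q; exact: cvg_fst].
Qed.

Lemma C1_snd V W X (A : set V) (f : V -> W * X) : C1 A f -> C1 A (fun x => (f x).2).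
Proof.
move=> fA; apply: (@C1_comp _ _ _ _ setT f snd) => //.
by apply: C1_linear; [exact: openT|move=> q; exact: cvg_snd].
Qed.

Lemma C1_add V W (A : set V) (f g : V -> W) :
  C1 A f -> C1 A g -> C1 A (fun x => f x + g x).
Proof.
move=> fA gA; apply: (@C1_intro _ _ _ _ (fun x v => 'D_v f x + 'D_v g x)).
- exact: C1_open fA.
- by move=> x Ax; apply: differentiableD; [exact: C1_diff fA Ax|exact: C1_diff gA Ax].
- move=> x v Ax; have [_ <-] := is_deriveD (C1_deriveP v fA Ax) (C1_deriveP v gA Ax).
  by [].
- move=> x v Ax; apply: cvgD; [exact: C1_derive_continuous fA Ax|exact: C1_derive_continuous gA Ax].
Qed.

Lemma C1_scale V W (A : set V) (k : V -> R) (w : W) :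
  C1 A k -> C1 A (fun x => k x *: w).
Proof.
move=> kA; apply: (@C1_comp _ _ _ _ setT k (fun c : R => c *: w)) => //.
have sD (c : R) : is_diff c (fun c : R => c *: w) (fun c => c *: w).
  exact: is_diff_scalel.
apply: (@C1_intro _ _ _ _ (fun (_ : R) (c : R) => c *: w)) => [|x _|x v _|x v _].
- exact: openT.
- by have [] := sD x.
- by have [dx E] := sD x; rewrite deriveE// E.
- by apply: cvgZr_tmp; exact: cvg_snd.
Qed.

Lemma C1_mul V (A : set V) (f g : V -> R) :
  C1 A f -> C1 A g -> C1 A (fun x => f x * g x).
Proof.
move=> fA gA; apply: (@C1_intro _ _ _ _ (fun x v => f x * 'D_v g x + g x * 'D_v f x)).
- exact: C1_open fA.
- by move=> x Ax; apply: differentiableM; [exact: C1_diff fA Ax|exact: C1_diff gA Ax].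
- move=> x v Ax; have [_ <-] := is_deriveM (C1_deriveP v fA Ax) (C1_deriveP v gA Ax).
  by [].
- move=> x v Ax; apply: cvgD; apply: cvgM.
  + by apply: continuous_at_comp; [exact: cvg_fst|exact: C1_continuous fA Ax].
  + exact: C1_derive_continuous gA Ax.
  + by apply: continuous_at_comp; [exact: cvg_fst|exact: C1_continuous gA Ax].
  + exact: C1_derive_continuous fA Ax.
Qed.

Lemma C1_inv V (A : set V) (f : V -> R) :
  C1 A f -> (forall x, A x -> f x != 0) -> C1 A (fun x => (f x)^-1).
Proof.
move=> fA f0; apply: (@C1_intro _ _ _ _ (fun x v => - (f x) ^- 2 * 'D_v f x)).
- exact: C1_open fA.
- by move=> x Ax; apply: differentiableV; [exact: C1_diff fA Ax|exact: f0].
- by move=> x v Ax; rewrite deriveV ?f0//; have [] := C1_deriveP v fA Ax.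
- move=> x v Ax; apply: cvgM; last exact: C1_derive_continuous fA Ax.
  have cf : {for (x, v), continuous (fun q : V * V => f q.1)}.
    by apply: continuous_at_comp; [exact: cvg_fst|exact: C1_continuous fA Ax].
  apply: cvgN; apply: cvgV; first by rewrite expf_neq0// f0.
  exact: (cvgM cf cf).
Qed.

Lemma C1_sum V W (A : set V) (I : Type) (r : seq I) (f : I -> V -> W) :
  open A -> (forall i, C1 A (f i)) -> C1 A (fun x => \sum_(i <- r) f i x).
Proof.
move=> oA fA; elim: r => [|i r IH].
  by under eq_fun do rewrite big_nil; exact: (C1_cst (0 : W) oA).
by under eq_fun do rewrite big_cons; exact: (C1_add (fA i) IH).
Qed.

Lemma C1_prod V (A : set V) (I : Type) (r : seq I) (f : I -> V -> R) :
  open A -> (forall i, C1 A (f i)) -> C1 A (fun x => \prod_(i <- r) f i x).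
Proof.
move=> oA fA; elim: r => [|i r IH].
  by under eq_fun do rewrite big_nil; exact: (C1_cst (1 : R) oA).
by under eq_fun do rewrite big_cons; exact: (C1_mul (fA i) IH).
Qed.

Lemma C1_det V (A : set V) (n : nat) (M : V -> 'M[R]_n) :
  open A -> (forall i j, C1 A (fun x => M x i j)) -> C1 A (fun x => \det (M x)).
Proof.
move=> oA MA; apply: C1_sum => // s; apply: C1_mul; first exact: C1_cst.
exact: C1_prod.
Qed.

(** Differentiability involves only the germ of the map. *)
Lemma near_differentiable V W (f g : V -> W) (x : V) :
  (\near x, f x = g x) -> differentiable f x -> differentiable g x.
Proof.
move=> fg df; have fgx : f x = g x by exact: nbhs_singleton fg.
have gL : g \o shift x = cst (g x) + ('d f x : V -> W) +o_ 0 id.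
  apply/eqaddoP => e e0; have /diff_locally/eqaddoP/(_ _ e0) := df.
  have fg0 : \forall h \near (0 : V), f (h + x) = g (h + x).
    by have := fg; rewrite (near_shift 0) /=; apply: filterS => h /=; rewrite subr0.
  by apply: filterS2 fg0 => h E; rewrite /= !fctE /= /shift/= E fgx.
have cL : continuous ('d f x) by exact: diff_continuous.
by apply/diff_locallyP; rewrite (diff_unique cL gL).
Qed.

Lemma C1_congr V W (A : set V) (f g : V -> W) :
  (forall x, A x -> f x = g x) -> C1 A f -> C1 A g.
Proof.
move=> fg fA; have oA := C1_open fA.
have near_fg x : A x -> \near x, f x = g x.
  by move=> Ax; apply: filterS fg _; exact: open_nbhs_nbhs.
apply: (@C1_intro _ _ _ _ (fun x v => 'D_v f x)) => //.
- by move=> x Ax; apply: near_differentiable (near_fg x Ax) _; exact: C1_diff fA Ax.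
- by move=> x v Ax; apply/esym/near_eq_derive; exact: near_fg.
- by move=> x v Ax; exact: C1_derive_continuous fA Ax.
Qed.

(** By Cramer's rule the entries of the inverse are rational functions of those of
    the matrix. *)
Lemma C1_invmx V (A : set V) (n : nat) (M : V -> 'M[R]_n) (i j : 'I_n) :
  open A -> (forall i j, C1 A (fun x => M x i j)) ->
  (forall x, A x -> M x \in unitmx) -> C1 A (fun x => invmx (M x) i j).
Proof.
move=> oA MA Mu.
apply: (@C1_congr _ _ _ (fun x => (\det (M x))^-1 * \adj (M x) i j)).
  by move=> x /Mu Mx; rewrite /invmx Mx [RHS]mxE.
apply: C1_mul.
  apply: C1_inv; first exact: C1_det.
  by move=> x /Mu; rewrite unitmxE unitfE.
under eq_fun do rewrite mxE; apply: C1_mul; first exact: C1_cst.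
by apply: C1_det => // k h; under eq_fun do rewrite !mxE; exact: MA.
Qed.

End ContinuouslyDifferentiable.

Section MatrixDerivatives.
Context {R : realType}.
Implicit Types V : normedModType R.

Lemma is_derive_entry V (p q : nat) (f : V -> 'M[R]_(p, q)) (x v : V) (D : 'M[R]_(p, q)) i j :
  is_derive x v f D -> is_derive x v (fun y => f y i j) (D i j).
Proof.
move=> [df <-]; have dfij := (derivable_mxP f x v).1 df i j.
by apply: (DeriveDef dfij); rewrite derive_mx// mxE.
Qed.

Lemma is_derive_mx V (p q : nat) (f : V -> 'M[R]_(p, q)) (x v : V) (D : 'M[R]_(p, q)) :
  (forall i j, is_derive x v (fun y => f y i j) (D i j)) -> is_derive x v f D.
Proof.
move=> dfij; have df : derivable f x v.
  by apply/derivable_mxP => i j; have [] := dfij i j.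
apply: (DeriveDef df); apply/matrixP => i j.
by rewrite derive_mx// mxE; have [] := dfij i j.
Qed.

Lemma continuous_at_entry (T : topologicalType) (p q : nat) (f : T -> 'M[R]_(p, q)) (x : T) i j :
  {for x, continuous f} -> {for x, continuous (fun y => f y i j)}.
Proof.
move=> cf; apply: (@continuous_at_comp _ _ _ f (fun M : 'M[R]_(p, q) => M i j) x cf).
exact: coord_continuous.
Qed.

Lemma C1_entry V (A : set V) (p q : nat) (f : V -> 'M[R]_(p, q)) i j :
  C1 A f -> C1 A (fun x => f x i j).
Proof.
move=> fA; apply: (@C1_intro _ _ _ _ _ (fun x v => 'D_v f x i j)).
- exact: C1_open fA.
- move=> x Ax; apply: (@differentiable_comp _ _ _ _ f (fun M => M i j)).
    exact: C1_diff fA Ax.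
  exact: differentiable_coord.
- by move=> x v Ax; have [_ ->] := is_derive_entry i j (C1_deriveP v fA Ax).
- by move=> x v Ax; exact: (@continuous_at_entry _ _ _
    (fun q : V * V => 'D_(q.2) f q.1) (x, v) i j (C1_derive_continuous fA Ax)).
Qed.

End MatrixDerivatives.

Section FiniteFrame.
Context {R : realType}.
Implicit Types V W : normedModType R.

(** A finite basis with continuous coordinates, in a form that products inherit. *)
Definition finite_frame V := exists (I : finType) (e : I -> V) (c : I -> V -> R),
  (forall i, continuous (c i)) /\ (forall v, v = \sum_i c i v *: e i).

Lemma finite_frame_scalar : finite_frame R.
Proof.
exists unit, (fun=> 1), (fun _ x => x); split => [_ x|v]; first exact: cvg_id.
by rewrite big_const card_unit /= addr0 [_ *: 1]mulr1.
Qed.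

Lemma finite_frame_cV (n : nat) : finite_frame 'cV[R]_n.
Proof.
exists 'I_n, (fun i => delta_mx i 0), (fun i (v : 'cV[R]_n) => v i 0); split => [i|v].
  exact: coord_continuous.
exact: cV_sum_delta.
Qed.

Lemma finite_frame_pair V W : finite_frame V -> finite_frame W ->
  finite_frame (V * W)%type.
Proof.
move=> [I [e [c [cc ce]]]] [J [e' [c' [cc' ce']]]].
exists (I + J)%type,
  (fun k => match k with inl i => (e i, 0) | inr j => (0, e' j) end),
  (fun k q => match k with inl i => c i q.1 | inr j => c' j q.2 end).
split => [[i|j] q|[v w]].
- exact: (@continuous_at_comp _ _ _ (fun q : V * W => q.1) (c i) q (continuous_at_fst (continuous_at_id q)) (cc i q.1)).
- exact: (@continuous_at_comp _ _ _ (fun q : V * W => q.2) (c' j) q (continuous_at_snd (continuous_at_id q)) (cc' j q.2)).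
rewrite big_sumType /=.
have -> : \sum_i c i v *: (e i, 0 : W) = (v, 0).
  apply/pair_eqP; rewrite /= (raddf_sum fst) (raddf_sum snd) /=.
  by rewrite -ce eqxx /=; apply/eqP/big1 => i _; rewrite scaler0.
have -> : \sum_j c' j w *: (0 : V, e' j) = (0, w).
  apply/pair_eqP; rewrite /= (raddf_sum fst) (raddf_sum snd) /=.
  by rewrite -ce' eqxx andbT; apply/eqP/big1 => i _; rewrite scaler0.
by congr pair; rewrite /= ?addr0 ?add0r.
Qed.

Lemma continuous_at_sum (T : topologicalType) W (I : Type) (r : seq I) (f : I -> T -> W) (x : T) :
  (forall i, {for x, continuous (f i)}) ->
  {for x, continuous (fun y => \sum_(i <- r) f i y)}.
Proof.
move=> cf; rewrite /prop_for /continuous_at; elim: r => [|i r IH].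
  by rewrite big_nil; under eq_fun do rewrite big_nil; exact: cvg_cst.
by rewrite big_cons; under eq_fun do rewrite big_cons; exact: (cvgD (cf i) IH).
Qed.

(** On finitely many coordinates, continuity of each directional derivative
    gives joint continuity in the point and the direction. *)
Lemma Ck1_C1 V W (A : set V) (f : V -> W) : finite_frame V ->
  open A -> Ck_at 1 A f -> C1 A f.
Proof.
move=> [I [e [c [cc ce]]]] oA [df cf].
apply: (@C1_intro _ _ _ _ _ (fun x v => \sum_i c i v *: 'D_(e i) f x)) => //.
- by move=> x v Ax; rewrite -derive_sumvec -?ce//; exact: df.
- move=> x v Ax; apply: continuous_at_sum => i; apply: cvgZ.
    exact: (@continuous_at_comp _ _ _ (fun q : V * V => q.2) (c i) (x, v)
      (continuous_at_snd (continuous_at_id (x, v))) (cc i v)).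
  exact: (@continuous_at_comp _ _ _ (fun q : V * V => q.1) (fun y => 'D_(e i) f y) (x, v)
    (continuous_at_fst (continuous_at_id (x, v))) (cf (e i) x Ax)).
Qed.

Lemma Ck2_C1_derive V W (A : set V) (f : V -> W) (v : V) : finite_frame V ->
  open A -> Ck_at 2 A f -> C1 A (fun x => 'D_v f x).
Proof. by move=> fV oA [_ cf]; exact: Ck1_C1 (cf v). Qed.

Lemma Ck2_C1 V W (A : set V) (f : V -> W) : finite_frame V ->
  open A -> Ck_at 2 A f -> C1 A f.
Proof.
move=> fV oA [df cf]; apply: Ck1_C1 => //; split => // v x Ax.
by apply: differentiable_continuous; have [+ _] := cf v; exact.
Qed.

End FiniteFrame.

(** * Mixed derivatives *)

Section MixedDerivatives.
Context {R : realType}.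

(** The second difference of [f] over a small rectangle equals the area times a
    nearby value of [k], by the mean value theorem in [t], then in [s].  Letting
    the side in [s] tend to 0 bounds the difference quotient of [p].  No second
    derivative other than [k] is assumed to exist. *)
Lemma mixed_derive (f g k : R -> R -> R) (p : R -> R) (t0 s0 : R) :
  (\forall q \near (t0, s0), is_derive (q.1 : R) 1 (fun t : R => f t q.2) (g q.1 q.2)) ->
  (\forall q \near (t0, s0), is_derive (q.2 : R) 1 (g q.1) (k q.1 q.2)) ->
  (\forall t \near t0, is_derive s0 1 (f t) (p t)) ->
  {for (t0, s0), continuous (fun q => k q.1 q.2)} ->
  is_derive t0 1 p (k t0 s0).
Proof.
move=> fg gk fp ck.
have lim : h^-1 *: (p (h *: 1 + t0) - p t0) @[h --> 0^'] --> k t0 s0.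
  apply/cvgrPdist_le => e e0.
  have e20 : 0 < e / 2 by rewrite divr_gt0.
  have ke : \forall q \near (t0, s0), `|k t0 s0 - k q.1 q.2| <= e / 2.
    by move/cvgrPdist_le : ck; exact.
  have /nbhs_ballP[d /= d0 dP] : \forall q \near (t0, s0),
      [/\ is_derive (q.1 : R) 1 (fun t : R => f t q.2) (g q.1 q.2),
          is_derive (q.2 : R) 1 (g q.1) (k q.1 q.2) &
          `|k t0 s0 - k q.1 q.2| <= e / 2].
    by apply: filterS3 fg gk ke => q.
  have {}dP (t s : R) : `|t - t0| < d -> `|s - s0| < d ->
      [/\ is_derive t 1 (fun t => f t s) (g t s), is_derive s 1 (g t) (k t s) &
          `|k t0 s0 - k t s| <= e / 2].
    by move=> td sd; apply: (dP (t, s)); split; rewrite /ball/= distrC.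
  have fp0 : \forall h \near 0^', is_derive s0 1 (f (t0 + h)) (p (t0 + h)).
    apply: nbhs_dnbhs; have := fp; rewrite (near_shift 0) /=.
    by apply: filterS => y /=; rewrite subr0 addrC.
  near=> h.
  have hd : `|h| < d by near: h; exact: dnbhs0_lt.
  have h0 : h != 0 by near: h; exact: nbhs_dnbhs_neq.
  have fpt0 : is_derive s0 1 (f t0) (p t0) by exact: (nbhs_singleton fp).
  have fph : is_derive s0 1 (f (t0 + h)) (p (t0 + h)) by near: h.
  rewrite [h *: 1]mulr1 [h + _]addrC.
  pose u (s : R) := s^-1 *: ((f (t0 + h) (s *: 1 + s0) - f t0 (s *: 1 + s0))
                       - (f (t0 + h) s0 - f t0 s0)).
  have ucvg : u s @[s --> 0^'] --> p (t0 + h) - p t0.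
    have [+ E] := is_deriveB fph fpt0; rewrite -E; exact.
  have ule (s : R) : s != 0 -> `|s| < d -> `|h * k t0 s0 - u s| <= `|h| * (e / 2).
    move=> sn0 sd.
    have df (t : R) : `|t - t0| < d ->
        is_derive t 1 (fun t => f t (s0 + s) - f t s0) (g t (s0 + s) - g t s0).
      move=> td; apply: is_deriveB.
        by have [] := dP t (s0 + s) td; rewrite ?[s0 + s]addrC ?addrK.
      by have [] := dP t s0 td; rewrite ?subrr ?normr0.
    have [c ch fE] := mvt_ball df hd.
    have dg (s1 : R) : `|s1 - s0| < d -> is_derive s1 1 (g c) (k c s1).
      by move=> s1d; have [] := dP c s1 (le_lt_trans ch hd) s1d.
    have [b bs gE] := mvt_ball dg sd.
    have uE : u s = h * k c b.
      rewrite /u [s *: 1]mulr1 [s + s0]addrC.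
      have -> : f (t0 + h) (s0 + s) - f t0 (s0 + s) - (f (t0 + h) s0 - f t0 s0) =
        f (t0 + h) (s0 + s) - f (t0 + h) s0 - (f t0 (s0 + s) - f t0 s0).
        by ring.
      by rewrite fE gE /=; change (s^-1 * (k c b * s * h) = h * k c b); field.
    rewrite uE -mulrBr normrM ler_wpM2l//.
    by have [] := dP c b (le_lt_trans ch hd) (le_lt_trans bs sd).
  have [s [sn0 sd us]] : exists s, [/\ s != 0, `|s| < d &
      `|(p (t0 + h) - p t0) - u s| <= `|h| * (e / 2)].
    have he : 0 < `|h| * (e / 2) by rewrite mulr_gt0 ?normr_gt0.
    have us : \forall s \near 0^', `|(p (t0 + h) - p t0) - u s| <= `|h| * (e / 2).
      by move/cvgrPdist_le : ucvg; exact.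
    near (0 : R)^' => s; exists s; split.
    - by near: s; exact: nbhs_dnbhs_neq.
    - by near: s; exact: dnbhs0_lt.
    - by near: s.
  have : `|h * k t0 s0 - (p (t0 + h) - p t0)| <= `|h| * e.
    rewrite -(subrKA (u s)) [in leRHS](splitr e) mulrDr.
    apply: le_trans (ler_normD _ _) _; apply: lerD; first exact: ule.
    by rewrite distrC.
  have -> : k t0 s0 - h^-1 *: (p (t0 + h) - p t0) =
      h^-1 * (h * k t0 s0 - (p (t0 + h) - p t0)).
    by rewrite mulrBr mulKf.
  by rewrite normrM normfV ler_pdivrMl ?normr_gt0.
split; first by apply/cvg_ex; exists (k t0 s0).
exact: cvg_lim lim.
Unshelve. all: by end_near. Qed.

End MixedDerivatives.

Section SecondDerivatives.
Context {R : realType}.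
Implicit Types V W : normedModType R.

Lemma is_derive_line V (x u : V) (t : R) : is_derive t 1 (fun s : R => x + s *: u) u.
Proof.
have du : is_derive t 1 (fun s : R => s *: u) u.
  have [dx E] : is_diff t (fun s : R => s *: u) (fun s => s *: u) by exact: is_diff_scalel.
  by split; [exact: diff_derivable|rewrite deriveE// E scale1r].
have := is_deriveD (is_derive_cst x t 1) du; rewrite add0r; exact.
Qed.

Lemma continuous_line V (x u : V) : continuous (fun s : R => x + s *: u).
Proof.
move=> t; apply: differentiable_continuous; apply/derivable1_diffP.
by have [] := is_derive_line x u t.
Qed.

(** On the plane through [x] spanned by [u] and [v], this is [mixed_derive]. *)
Lemma derive_symmetric V (A : set V) (f : V -> R) (x u v : V) :
  C1 A f -> (forall w, C1 A (fun y => 'D_w f y)) -> A x ->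
  'D_u (fun y => 'D_v f y) x = 'D_v (fun y => 'D_u f y) x.
Proof.
move=> fA f'A Ax.
pose y (t s : R) := x + t *: u + s *: v.
have y0 : y 0 0 = x by rewrite /y !scale0r !addr0.
have cy : {for (0 : R, 0 : R), continuous (fun q => y q.1 q.2)}.
  apply: cvgD; last by apply: cvgZr_tmp; exact: cvg_snd.
  by apply: cvgD; [exact: cvg_cst|apply: cvgZr_tmp; exact: cvg_fst].
have Ay : \forall q \near (0 : R, 0 : R), A (y q.1 q.2).
  by apply: cy; rewrite /= y0; apply: open_nbhs_nbhs; split => //; exact: C1_open fA.
have dyt (t s : R) : is_derive t 1 (fun t => y t s) u.
  have := is_derive_line (x + s *: v) u t; congr (is_derive _ _ _ _).
  by apply/funext => t'; rewrite /y addrAC.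
have dys (t s : R) : is_derive s 1 (y t) v := is_derive_line _ _ _.
have ft : \forall q \near (0 : R, 0 : R),
    is_derive (q.1 : R) 1 (fun t : R => f (y t q.2)) ('D_u f (y q.1 q.2)).
  by apply: filterS Ay => q Aq; exact: (is_derive_comp (dyt q.1 q.2) (C1_diff fA Aq)).
have gs : \forall q \near (0 : R, 0 : R), is_derive (q.2 : R) 1
    (fun s : R => 'D_u f (y q.1 s)) ('D_v (fun y => 'D_u f y) (y q.1 q.2)).
  by apply: filterS Ay => q Aq; exact: (is_derive_comp (dys q.1 q.2) (C1_diff (f'A u) Aq)).
have fs : \forall t \near (0 : R),
    is_derive (0 : R) 1 (fun s : R => f (y t s)) ('D_v f (y t 0)).
  have : \forall t \near (0 : R), A (y t 0).
    have cyt : {for (0 : R), continuous (fun t => y t 0)}.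
      by apply: differentiable_continuous; apply/derivable1_diffP; have [] := dyt 0 0.
    by apply: cyt; rewrite /= y0; apply: open_nbhs_nbhs; split => //; exact: C1_open fA.
  by apply: filterS => t At; exact: (is_derive_comp (dys t 0) (C1_diff fA At)).
have ck : {for (0 : R, 0 : R),
    continuous (fun q : R * R => 'D_v (fun y => 'D_u f y) (y q.1 q.2))}.
  apply: (@continuous_at_comp _ _ _ (fun q : R * R => y q.1 q.2)
    (fun z => 'D_v (fun y => 'D_u f y) z)) => //=; rewrite y0.
  have cD := @C1_derive_continuous _ _ _ _ _ x v (f'A u) Ax.
  exact: (@continuous_at_comp2 _ _ _ _ (fun z w => 'D_w (fun y => 'D_u f y) z) (fun z => z)
    (fun=> v) x (continuous_at_id x) (continuous_at_cst v x) cD).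
have := @mixed_derive R (fun t s => f (y t s)) (fun t s => 'D_u f (y t s))
  (fun t s => 'D_v (fun y => 'D_u f y) (y t s)) (fun t => 'D_v f (y t 0)) 0 0 ft gs fs ck.
rewrite y0.
move=> [_ <-].
have Ay00 : A (y 0 0) by rewrite y0.
have [_ E] := is_derive_comp (dyt 0 0) (C1_diff (f'A v) Ay00).
by move: E; rewrite y0 => ->.
Qed.

End SecondDerivatives.

(** * The symplectic form *)

Section BilinearForm.
Context {R : realType} {N : nat}.
Implicit Types (M : 'M[R]_N) (x y : 'cV[R]_N).

Definition bilin M x y : R := \sum_(i < N) \sum_(j < N) x i 0 * M i j * y j 0.

Lemma bilinE M x y : bilin M x y = (x^T *m M *m y) 0 0.
Proof.
rewrite -mulmxA mxE; apply: eq_bigr => i _.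
rewrite !mxE mulr_sumr; apply: eq_bigr => j _.
by rewrite mulrA.
Qed.

Lemma bilin_tr M x y : bilin M^T x y = bilin M y x.
Proof.
rewrite /bilin exchange_big; apply: eq_bigr => i _; apply: eq_bigr => j _.
by rewrite mxE; ring.
Qed.

Lemma bilin_opp M x y : bilin (- M) x y = - bilin M x y.
Proof.
rewrite /bilin -sumrN; apply: eq_bigr => i _; rewrite -sumrN.
by apply: eq_bigr => j _; rewrite mxE mulrN mulNr.
Qed.

Lemma is_derive_bilin (V : normedModType R) (M : V -> 'M[R]_N)
    (x y : V -> 'cV[R]_N) (p v : V) dM dx dy :
  is_derive p v M dM -> is_derive p v x dx -> is_derive p v y dy ->
  is_derive p v (fun q => bilin (M q) (x q) (y q))
    (bilin (M p) dx (y p) + bilin dM (x p) (y p) + bilin (M p) (x p) dy).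
Proof.
move=> Mp xp yp.
have dterm i j : is_derive p v (fun q => x q i 0 * M q i j * y q j 0)
    (dx i 0 * M p i j * y p j 0 + x p i 0 * dM i j * y p j 0 +
     x p i 0 * M p i j * dy j 0).
  have dxM := is_deriveM (is_derive_entry i 0 xp) (is_derive_entry i j Mp).
  apply: is_derive_eq (is_deriveM dxM (is_derive_entry j 0 yp)) _.
  by rewrite fctE /GRing.scale /=; ring.
have dsum := is_derive_sum (fun i => is_derive_sum (dterm i)).
have -> : (fun q => bilin (M q) (x q) (y q)) =
    \sum_(i < N) \sum_(j < N) (fun q => x q i 0 * M q i j * y q j 0).
  apply/funext => q; rewrite fct_sumE; apply: eq_bigr => i _.
  by rewrite fct_sumE.
apply: is_derive_eq dsum _.
rewrite /bilin -!big_split; apply: eq_bigr => i _ /=.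
by rewrite -!big_split.
Qed.

Lemma is_derive_bilin_const (V : normedModType R) (M : V -> 'M[R]_N) x y
    (p v : V) (dM : 'M[R]_N) :
  is_derive p v M dM -> is_derive p v (fun q => bilin (M q) x y) (bilin dM x y).
Proof.
move=> Mp; apply: is_derive_eq (is_derive_bilin Mp (is_derive_cst x p v) (is_derive_cst y p v)) _.
rewrite [X in X + _ + _]big1 ?[X in _ + X]big1 ?addr0 ?add0r// => i _; apply: big1 => j _.
  by rewrite mxE mulr0.
by rewrite mxE !mul0r.
Qed.

End BilinearForm.

Section SymplecticForm.
Context {R : realType} {N : nat}.
Variables (U : set 'cV[R]_N) (a : 'cV[R]_N -> 'cV[R]_N).
Hypotheses (U_open : open U) (aU : C1 U a) (a'U : forall v, C1 U (fun y => 'D_v a y)).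
Implicit Types (x y : 'cV[R]_N).

(* The contraction of the primitive one-form with a constant vector. *)
Let pairing x y : R := \sum_(i < N) a y i 0 * x i 0.

Lemma OmegaE z i j : Omega a z i j =
  ('D_(delta_mx i 0) a z) j 0 - ('D_(delta_mx j 0) a z) i 0.
Proof. by rewrite !mxE. Qed.

Lemma C1_Omega : C1 U (Omega a).
Proof.
apply: (@C1_congr _ _ _ _ (fun z => \sum_i \sum_j Omega a z i j *: delta_mx i j)).
  by move=> z _; rewrite -matrix_sum_delta.
apply: (C1_sum _ U_open) => i; apply: (C1_sum _ U_open) => j; apply: C1_scale.
under eq_fun do rewrite OmegaE -mulN1r.
apply: C1_add; first by apply: C1_entry; exact: a'U.
by apply: C1_mul; [exact: C1_cst|apply: C1_entry; exact: a'U].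
Qed.

Lemma Omega_antisym z x y : bilin (Omega a z) x y = - bilin (Omega a z) y x.
Proof. by rewrite -bilin_tr -bilin_opp; congr bilin; rewrite linearB/= trmxK opprB. Qed.

Lemma dOmega_antisym z v x y : U z ->
  bilin ('D_v (Omega a) z) x y = - bilin ('D_v (Omega a) z) y x.
Proof.
move=> Uz; rewrite -bilin_tr -bilin_opp; congr bilin; apply/matrixP => i j.
rewrite mxE [RHS]mxE.
have dO := C1_deriveP v C1_Omega Uz.
have [_ <-] := is_derive_entry j i dO.
have [_ <-] := is_deriveN (is_derive_entry i j dO).
congr ('D_v _ z); apply/funext => q; rewrite fctE !OmegaE.
by rewrite opprB.
Qed.

Let C1_pairing x : C1 U (pairing x).
Proof.
apply: C1_sum => // i; apply: C1_mul; last exact: C1_cst.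
exact: C1_entry.
Qed.

Let derive_pairing x v z : U z ->
  'D_v (pairing x) z = \sum_(i < N) ('D_v a z) i 0 * x i 0.
Proof.
move=> Uz.
have dterm i : is_derive z v (fun y => a y i 0 * x i 0) (('D_v a z) i 0 * x i 0).
  have dM := is_deriveM (is_derive_entry i 0 (C1_deriveP v aU Uz)) (is_derive_cst (x i 0 : R) z v).
  by apply: (is_derive_eq dM); rewrite scaler0 add0r [LHS]mulrC.
have [_ <-] := is_derive_sum dterm.
by congr ('D_v _ z); apply/funext => y; rewrite fct_sumE.
Qed.

Let C1_derive_pairing x v : C1 U (fun y => 'D_v (pairing x) y).
Proof.
apply: (@C1_congr _ _ _ _ (fun y => \sum_(i < N) ('D_v a y) i 0 * x i 0)).
  by move=> y Uy; rewrite derive_pairing.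
apply: C1_sum => // i; apply: C1_mul; last exact: C1_cst.
by apply: C1_entry; exact: a'U.
Qed.

(** For constant vector fields the bracket term in the exterior derivative of the
    primitive one-form vanishes. *)
Lemma bilin_OmegaE z x y : U z ->
  bilin (Omega a z) x y = 'D_x (pairing y) z - 'D_y (pairing x) z.
Proof.
move=> Uz; rewrite !derive_pairing//.
have Da (u : 'cV[R]_N) j : ('D_u a z) j 0 = \sum_(i < N) u i 0 * ('D_(delta_mx i 0) a z) j 0.
  rewrite [in LHS](cV_sum_delta u) derive_sumvec; last exact: C1_diff aU Uz.
  by rewrite summxE; apply: eq_bigr => i _; rewrite mxE.
under [X in _ = X - _]eq_bigr do rewrite Da mulr_suml.
under [X in _ = _ - X]eq_bigr do rewrite Da mulr_suml.
rewrite exchange_big /bilin -sumrB; apply: eq_bigr => i _.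
rewrite -sumrB; apply: eq_bigr => j _.
by rewrite OmegaE; ring.
Qed.

(** Closedness of the exterior derivative of [a]: by [bilin_OmegaE] the cyclic sum
    consists of six second derivatives that cancel in pairs. *)
Lemma dOmega_closed z x y v : U z ->
  bilin ('D_v (Omega a) z) x y + bilin ('D_x (Omega a) z) y v +
  bilin ('D_y (Omega a) z) v x = 0.
Proof.
move=> Uz.
have dE u p q : bilin ('D_u (Omega a) z) p q =
    'D_u (fun z => 'D_p (pairing q) z) z - 'D_u (fun z => 'D_q (pairing p) z) z.
  have dO := is_derive_bilin_const p q (C1_deriveP u C1_Omega Uz).
  have dP := is_deriveB (C1_deriveP u (C1_derive_pairing q p) Uz)
    (C1_deriveP u (C1_derive_pairing p q) Uz).
  case: dO => _ <-; case: dP => _ <-; apply: near_eq_derive.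
  have : \forall y \near z, U y by exact: open_nbhs_nbhs.
  by apply: filterS => w Uw; rewrite bilin_OmegaE.
have sym u p q : 'D_u (fun z => 'D_p (pairing q) z) z = 'D_p (fun z => 'D_u (pairing q) z) z.
  exact: (derive_symmetric u p (C1_pairing q) (C1_derive_pairing q) Uz).
(* The second derivatives are abstracted before the linear algebra. *)
have [T dT symT] : exists2 T : 'cV[R]_N -> 'cV[R]_N -> 'cV[R]_N -> R,
    forall u p q, bilin ('D_u (Omega a) z) p q = T u p q - T u q p &
    forall u p q, T u p q = T p u q.
  by exists (fun u p q => 'D_u (fun z => 'D_p (pairing q) z) z).
have cyc (b1 b2 b3 t1 t2 t3 t4 t5 t6 : R) : b1 = t1 - t2 -> b2 = t3 - t4 ->
    b3 = t5 - t6 -> t1 = t4 -> t2 = t5 -> t3 = t6 -> b1 + b2 + b3 = 0.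
  by move=> -> -> -> -> -> ->; ring.
exact: (cyc _ _ _ _ _ _ _ _ _ (dT v x y) (dT x y v) (dT y v x)
  (symT v x y) (symT v y x) (symT x y v)).
Qed.

End SymplecticForm.

(** * The Hamiltonian vector field *)

Section HamiltonianField.
Context {R : realType} {N l : nat}.
Variables (U : set 'cV[R]_N) (a : 'cV[R]_N -> 'cV[R]_N)
  (H : R -> 'cV[R]_N -> 'cV[R]_l -> R).
Let A : set (R * 'cV[R]_N * 'cV[R]_l) := [set p | U p.1.2].
Let HH (p : R * 'cV[R]_N * 'cV[R]_l) : R := H p.1.1 p.1.2 p.2.
Let XX (p : R * 'cV[R]_N * 'cV[R]_l) := hamiltonian_field a H p.1.1 p.1.2 p.2.
Hypotheses (U_open : open U) (aU : C1 U a) (a'U : forall v, C1 U (fun y => 'D_v a y)).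
Hypotheses (Omega_inv : forall z, U z -> Omega a z \in unitmx).
Hypotheses (HA : C1 A HH) (H'A : forall v, C1 A (fun p => 'D_v HH p)).

Let A_open : open A. Proof. exact: C1_open HA. Qed.

Lemma derive_phase_slice e z ph xi : U z ->
  'D_xi (fun z' => H e z' ph) z = 'D_(0, xi, 0) HH (e, z, ph).
Proof.
move=> Uz; have d : is_derive z xi (fun z' => (e, z', ph)) (0, xi, 0).
  exact: (is_derive_pair (is_derive_pair (is_derive_cst (e : R) z xi)
    (is_derive_id z xi)) (is_derive_cst ph z xi)).
have Az : A (e, z, ph) by [].
by have [_ E] := is_derive_comp d (C1_diff HA Az).
Qed.

Lemma hamiltonian_equation p xi : A p ->
  bilin (Omega a p.1.2) xi (XX p) = 'D_(0, xi, 0) HH p.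
Proof.
case: p => [[e z] ph] Ap; rewrite -derive_phase_slice//.
rewrite bilinE -mulmxA mulKVmx; last exact: Omega_inv.
have dH : differentiable (fun z' => H e z' ph) z.
  apply: (@differentiable_comp _ _ _ _ (fun z' => (e, z', ph)) HH); last exact: C1_diff HA Ap.
  by apply: differentiable_pair => //; apply: differentiable_pair.
rewrite [in RHS](cV_sum_delta xi) derive_sumvec// mxE; apply: eq_bigr => i _.
by rewrite !mxE.
Qed.

Lemma C1_hamiltonian_field : C1 A XX.
Proof.
apply: (@C1_congr _ _ _ _ (fun p => \sum_(i < N)
    (\sum_(j < N) invmx (Omega a p.1.2) i j * 'D_(0, delta_mx j 0, 0) HH p) *: delta_mx i 0)).
  move=> [[e z] ph] Ap; rewrite [RHS]matrix_sum_delta; apply: eq_bigr => i _.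
  rewrite big_ord_recl big_ord0 addr0 ord1 mxE; congr (_ *: _).
  apply: eq_bigr => j _; rewrite !mxE; congr (_ * _).
  by rewrite derive_phase_slice.
apply: (C1_sum _ A_open) => i; apply: C1_scale.
apply: (C1_sum _ A_open) => j; apply: C1_mul; last exact: H'A.
apply: (C1_invmx _ _ A_open) => [i' j'|p Ap]; last exact: Omega_inv.
apply: C1_entry.
have zA : C1 A (fun p => p.1.2) by apply: C1_snd; apply: C1_fst; exact: C1_id.
exact: (C1_comp zA (C1_Omega U_open a'U) (fun p Ap => Ap)).
Qed.

(** The derivative of both sides of [hamiltonian_equation] with [xi] fixed. *)
Lemma derive_hamiltonian_equation p xi s eta : A p ->
  bilin ('D_eta (Omega a) p.1.2) xi (XX p) +
  bilin (Omega a p.1.2) xi ('D_(s, eta, 0) XX p) =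
  'D_(s, eta, 0) (fun p => 'D_(0, xi, 0) HH p) p.
Proof.
move=> Ap; set u := (s, eta, 0).
have dz : is_derive p u (fun p => p.1.2) eta.
  exact: (is_derive_snd (is_derive_fst (is_derive_id p u))).
have dO : is_derive p u (fun p => Omega a p.1.2) ('D_eta (Omega a) p.1.2).
  exact: (is_derive_comp dz (C1_diff (C1_Omega U_open a'U) Ap)).
have dX := C1_deriveP u C1_hamiltonian_field Ap.
have [_] := is_derive_bilin dO (is_derive_cst xi p u) dX.
rewrite [X in _ = X + _ + _ -> _]big1 ?add0r; last first.
  by move=> i _; apply: big1 => j _; rewrite mxE !mul0r.
move=> <-; apply: near_eq_derive.
have : \forall q \near p, A q by exact: open_nbhs_nbhs.
by apply: filterS => q Aq; rewrite hamiltonian_equation.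
Qed.

(** When [w] evolves by the linearized equation, and [v] by the linearized equation
    with the additional source due to the parameter, the left-hand side is the time
    derivative of [bilin Omega w v].  Substituting [derive_hamiltonian_equation] for
    the two terms with the derivative of the field leaves second derivatives of
    the Hamiltonian, which cancel up to one mixed derivative with the parameter,
    and the cyclic sum of [dOmega_closed]. *)
Lemma symplectic_rate p w v : A p ->
  bilin (Omega a p.1.2) ('D_(0, w, 0) XX p) v +
  bilin ('D_(XX p) (Omega a) p.1.2) w v +
  bilin (Omega a p.1.2) w ('D_(1, v, 0) XX p) =
  'D_(0, w, 0) (fun q => 'D_(1, 0, 0) HH q) p.
Proof.
move=> Ap.
have lin (b1 b2 b3 b4 b5 b6 b7 d1 d2 d3 d4 d5 d6 : R) :
  b1 + b2 = d1 -> b3 + b4 = d2 -> b5 = - b2 -> b3 = - b6 -> b7 + b1 + b6 = 0 ->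
  d1 = d3 -> d4 = d5 -> d2 = d5 + d3 -> b5 + b7 + b4 = d4.
  by lra.
have Uz : U p.1.2 by [].
have Ew := derive_hamiltonian_equation v 0 w Ap.
have Ev := derive_hamiltonian_equation w 1 v Ap.
have anti := Omega_antisym a p.1.2 ('D_(0, w, 0) XX p) v.
have danti := dOmega_antisym U_open a'U v w (XX p) Uz.
have closed := dOmega_closed U_open aU a'U w v (XX p) Uz.
have sym1 := derive_symmetric (0 : R, w, 0 : 'cV[R]_l) (0 : R, v, 0 : 'cV[R]_l) HA H'A Ap.
have sym2 := derive_symmetric (0 : R, w, 0 : 'cV[R]_l) (1 : R, 0 : 'cV[R]_N, 0 : 'cV[R]_l) HA H'A Ap.
have split1 : 'D_(1, v, 0) (fun p => 'D_(0, w, 0) HH p) p =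
    'D_(1, 0, 0) (fun p => 'D_(0, w, 0) HH p) p + 'D_(0, v, 0) (fun p => 'D_(0, w, 0) HH p) p.
  have -> : (1 : R, v, 0 : 'cV[R]_l) = (1, 0, 0) + (0, v, 0).
    by apply: (f_equal2 pair); [apply: (f_equal2 pair)|]; rewrite /= ?addr0 ?add0r.
  exact: (deriveDvec _ _ (C1_diff (H'A (0 : R, w, 0 : 'cV[R]_l)) Ap)).
exact: (lin _ _ _ _ _ _ _ _ _ _ _ _ 0 Ew Ev anti danti closed sym1 sym2 split1).
Qed.

End HamiltonianField.

(** * The variational equation *)

Section Variation.
Context {R : realType} {N l : nat}.
Variables (A : set (R * 'cV[R]_N * 'cV[R]_l)) (X : R * 'cV[R]_N * 'cV[R]_l -> 'cV[R]_N).
Hypothesis XA : C1 A X.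

(** The derivative in [t] of [Y] is the field along [Y], which is C^1 in [s];
    [mixed_derive] then gives the derivative in [t] of the derivative in [s]. *)
Lemma variational_equation (O : set (R * R)) (Y : R * R -> 'cV[R]_N)
    (e : R -> R) (sigma : R) (p : R -> 'cV[R]_l) (t0 s0 : R) :
  C1 O Y -> continuous p -> (forall s : R, is_derive s 1 e sigma) -> O (t0, s0) ->
  (forall q : R * R, O q -> A (e q.2, Y q, p q.1)) ->
  (forall q : R * R, O q -> is_derive (q.1 : R) 1 (fun t => Y (t, q.2)) (X (e q.2, Y q, p q.1))) ->
  is_derive t0 1 (fun t => 'D_(0, 1) Y (t, s0))
    ('D_(sigma, 'D_(0, 1) Y (t0, s0), 0) X (e s0, Y (t0, s0), p t0)).
Proof.
move=> YO cp de O0 YA dY.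
have ce : continuous e.
  by move=> s; apply: differentiable_continuous; apply/derivable1_diffP; have [] := de s.
have near_O : \forall q \near (t0, s0), O q.
  by apply: open_nbhs_nbhs; split => //; exact: C1_open YO.
have dYs (q : R * R) : O q ->
    is_derive (q.2 : R) 1 (fun s => Y (q.1, s)) ('D_(0, 1) Y q).
  case: q => t s Oq.
  exact: (is_derive_comp (is_derive_pair (is_derive_cst (t : R) s 1) (is_derive_id s 1)) (C1_diff YO Oq)).
apply: is_derive_mx => i j.
have XAij := C1_entry i j XA.
apply: (@mixed_derive R (fun t s => Y (t, s) i j) (fun t s => X (e s, Y (t, s), p t) i j)
  (fun t s => 'D_(sigma, 'D_(0, 1) Y (t, s), 0) X (e s, Y (t, s), p t) i j)
  (fun t => 'D_(0, 1) Y (t, s0) i j) t0 s0).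
- by apply: filterS near_O => -[t s] Oq; exact: (is_derive_entry i j (dY _ Oq)).
- apply: filterS near_O => -[t s] Oq; apply: is_derive_entry.
  exact: (is_derive_comp (is_derive_pair (is_derive_pair (de s) (dYs _ Oq))
    (is_derive_cst (p t) s 1)) (C1_diff XA (YA _ Oq))).
- have : \forall t \near t0, O (t, s0).
    exact: (continuous_at_pair (continuous_at_id t0) (continuous_at_cst s0 t0) near_O).
  by apply: filterS => t Ot; exact: (is_derive_entry i j (dYs _ Ot)).
- have cY : {for (t0, s0), continuous Y} := C1_continuous YO O0.
  have cDY : {for (t0, s0), continuous (fun q => 'D_(0, 1) Y q)}.
    exact: C1_derive_dir_continuous YO O0.
  have cpt : {for (t0, s0), continuous (fun q : R * R => (e q.2, Y q, p q.1))}.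
    apply: continuous_at_pair; last exact: (continuous_at_comp (continuous_at_fst (continuous_at_id (t0, s0))) (cp t0)).
    by apply: continuous_at_pair => //; exact: (continuous_at_comp (continuous_at_snd (continuous_at_id (t0, s0))) (ce s0)).
  have cdir : {for (t0, s0), continuous (fun q : R * R =>
      (sigma, 'D_(0, 1) Y q, 0 : 'cV[R]_l))}.
    exact: (continuous_at_pair (continuous_at_pair (continuous_at_cst sigma _) cDY) (continuous_at_cst (0 : 'cV[R]_l) _)).
  have cDX := C1_derive_continuous_comp XA (YA _ O0) cpt cdir.
  have cDXij := @continuous_at_entry _ _ _ _ (fun q : R * R =>
    'D_(sigma, 'D_(0, 1) Y q, 0) X (e q.2, Y q, p q.1)) (t0, s0) i j cDX.
  exact: (continuous_at_comp (continuous_at_pair (continuous_at_fst (continuous_at_id (t0, s0))) (continuous_at_snd (continuous_at_id (t0, s0)))) cDXij).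
Qed.

End Variation.

(** * The flow near the invariant torus *)

Lemma cube_representative {R : realType} {m : nat} (v : 'cV[R]_m) :
  exists k : 'cV[int]_m, cube (v + map_mx intr k).
Proof.
exists (\col_i - Num.floor (v i 0)) => i; rewrite !mxE /= in_itv/= mulrNz subr_ge0 floor_le/=.
have /andP[_ /ltW] := floor_itv (v i 0).
by rewrite lerBlDr intrD addrC.
Qed.

Section Flow.
Context {R : realType} {N l : nat}.
Variables (U : set 'cV[R]_N) (a : 'cV[R]_N -> 'cV[R]_N)
  (H : R -> 'cV[R]_N -> 'cV[R]_l -> R) (alphahat : 'cV[R]_l)
  (dom : set (R * R * 'cV[R]_N * 'cV[R]_l))
  (phi : R -> R -> 'cV[R]_N -> 'cV[R]_l -> 'cV[R]_N).
Hypotheses (U_open : open U) (H_periodic : forall e z, U z -> Zperiodic (H e z))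
  (phi_flow : is_flow U a H alphahat dom phi).

Lemma hamiltonian_field_periodic e z ph (k : 'cV[int]_l) : U z ->
  hamiltonian_field a H e z (ph + map_mx intr k) = hamiltonian_field a H e z ph.
Proof.
move=> Uz; congr (_ *m _^T); apply/rowP => j; rewrite !mxE.
apply: near_eq_derive; have : \forall y \near z, U y by exact: open_nbhs_nbhs.
by apply: filterS => y Uy; exact: H_periodic.
Qed.

Lemma flow_start t e z ph : dom (t, e, z, ph) -> U z.
Proof. by have [+ _] := phi_flow; exact. Qed.

Lemma flow_deriv t e z ph : dom (t, e, z, ph) ->
  U (phi t e z ph) /\ is_derive t 1 (fun t => phi t e z ph)
    (hamiltonian_field a H e (phi t e z ph) (ph + t *: alphahat)).
Proof.
move=> D; have [_ /(_ e z ph (flow_start D))[[_ _ _ _ sol] _]] := phi_flow.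
exact: sol.
Qed.

Lemma flow0 e z ph : U z -> dom (0, e, z, ph) /\ phi 0 e z ph = z.
Proof. by move=> Uz; have [_ /(_ e z ph Uz)[[]]] := phi_flow. Qed.

Lemma flow_interval t T e z ph : dom (T, e, z, ph) -> 0 <= t <= T ->
  dom (t, e, z, ph).
Proof.
move=> D tT; have [_ /(_ e z ph (flow_start D))[[_ itv J0 _ _] _]] := phi_flow.
exact: itv J0 D _ tT.
Qed.

(** A solution for the phase [ph] is also one for the shifted phase, because the
    field is periodic; the maximal solution extends it. *)
Lemma flow_periodic t e z ph (k : 'cV[int]_l) : dom (t, e, z, ph) ->
  dom (t, e, z, ph + map_mx intr k) /\
  phi t e z (ph + map_mx intr k) = phi t e z ph.
Proof.
move=> D; have Uz := flow_start D.
have [_ flow] := phi_flow.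
have [[oJ iJ J0 y0 sol] _] := flow e z ph Uz.
have [_ max] := flow e z (ph + map_mx intr k) Uz.
have [//|+ ->//] := max [set t | dom (t, e, z, ph)] (fun t => phi t e z ph) _ t D.
split => // s /sol[Uy dy]; split => //.
by rewrite addrAC hamiltonian_field_periodic.
Qed.

Section Torus.
Context {m : nat}.
Variables (K : 'cV[R]_m -> 'cV[R]_l -> 'cV[R]_N) (eps : R).
Hypotheses (dom_open : open dom)
  (K_continuous : continuous (fun q => K q.1 q.2))
  (K_periodic_theta : forall ph, Zperiodic (fun theta => K theta ph))
  (K_periodic_phi : forall theta, Zperiodic (K theta)).

(** By periodicity it suffices to control the points of a compact cube. *)
Lemma torus_times_open : open [set t | forall th ph, dom (t, eps, K th ph, ph)].
Proof.
rewrite openE => t0 Jt0; rewrite /interior.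
have : \forall t \near t0, (cube (R:=R) (m:=m) `*` cube (R:=R) (m:=l)) `<=`
    (fun q => dom (t, eps, K q.1 q.2, q.2)).
  have cov := (compact_near_coveringP _).1
    (compact_setX (@cube_compact R m) (@cube_compact R l)).
  apply: (cov R (nbhs t0) (fun t q => dom (t, eps, K q.1 q.2, q.2))) => -[th ph] _.
  have cg : (fun q : ('cV[R]_m * 'cV[R]_l) * R => (q.2, eps, K q.1.1 q.1.2, q.1.2))
      @ nbhs ((th, ph), t0) --> (t0, eps, K th ph, ph).
    apply: continuous_at_pair; last by apply: continuous_at_snd; apply: continuous_at_fst; exact: continuous_at_id.
    apply: continuous_at_pair.
      by apply: continuous_at_pair; [apply: continuous_at_snd; exact: continuous_at_id|exact: continuous_at_cst].
    have c1 : {for ((th, ph), t0), continuous (fun q : ('cV[R]_m * 'cV[R]_l) * R => q.1)}.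
      by apply: continuous_at_fst; exact: continuous_at_id.
    exact: (continuous_at_comp c1 (@K_continuous (th, ph))).
  by apply: cg; apply: open_nbhs_nbhs; split => //; exact: Jt0.
apply: filterS => t Dt th ph.
have [k1 k1P] := cube_representative th.
have [k2 k2P] := cube_representative ph.
have /= D := Dt (th + map_mx intr k1, ph + map_mx intr k2) (conj k1P k2P).
have [+ _] := flow_periodic (- k2) D.
by rewrite raddfN addrK K_periodic_theta K_periodic_phi.
Qed.

End Torus.
End Flow.

(** * The averaged identity *)

Section Average.
Context {R : realType} {N l m : nat}.
Variables (U : set 'cV[R]_N) (a : 'cV[R]_N -> 'cV[R]_N)
  (H : R -> 'cV[R]_N -> 'cV[R]_l -> R) (alphahat : 'cV[R]_l)
  (dom : set (R * R * 'cV[R]_N * 'cV[R]_l))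
  (phi : R -> R -> 'cV[R]_N -> 'cV[R]_l -> 'cV[R]_N)
  (T : R) (omega : 'cV[R]_m) (eps : R)
  (K : 'cV[R]_m -> 'cV[R]_l -> 'cV[R]_N).
Let A : set (R * 'cV[R]_N * 'cV[R]_l) := [set p | U p.1.2].
Let HH (p : R * 'cV[R]_N * 'cV[R]_l) : R := H p.1.1 p.1.2 p.2.
Let XX (p : R * 'cV[R]_N * 'cV[R]_l) := hamiltonian_field a H p.1.1 p.1.2 p.2.
Let flow_map (p : R * R * 'cV[R]_N * 'cV[R]_l) := phi p.1.1.1 p.1.1.2 p.1.2 p.2.
Hypotheses (U_open : open U) (aU : C1 U a) (a'U : forall xi, C1 U (fun y => 'D_xi a y))
  (Omega_inv : forall z, U z -> Omega a z \in unitmx)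
  (H_periodic : forall e z, U z -> Zperiodic (H e z))
  (HA : C1 A HH) (H'A : forall xi, C1 A (fun p => 'D_xi HH p))
  (phi_flow : is_flow U a H alphahat dom phi) (flow_C1 : C1 dom flow_map) (T_ge0 : 0 <= T)
  (K_periodic_theta : forall ph, Zperiodic (fun theta => K theta ph))
  (K_periodic_phi : forall theta, Zperiodic (K theta))
  (K_C1 : C1 [set: 'cV[R]_m * 'cV[R]_l] (fun q => K q.1 q.2))
  (K_in_U : forall theta ph, U (K theta ph))
  (phi_defined : forall theta ph, dom (T, eps, K theta ph, ph))
  (K_invariant : forall theta ph,
     phi T eps (K theta ph) ph = K (theta + omega) (ph + T *: alphahat)).
Variables (c : R) (u : 'cV[R]_m).

Local Notation ext := (R * ('cV[R]_m * 'cV[R]_l))%type.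
(* Along [d] the time grows at rate [c] and the phase decreases at rate
   [c *: alphahat]: the phase [ph + t *: alphahat] entering the field is kept. *)
Let d : ext := (c, (u, - (c *: alphahat))).
Let J : set R := [set t | forall th ph, dom (t, eps, K th ph, ph)].
Let JJ : set ext := [set q | J q.1].
Let start (q : ext) := (q.1, eps, K q.2.1 q.2.2, q.2.2).
Let orbit (q : ext) : 'cV[R]_N := phi q.1 eps (K q.2.1 q.2.2) q.2.2.
Let state (q : ext) := (eps, orbit q, q.2.2 + q.1 *: alphahat).
Let tangent (q : ext) : 'cV[R]_N := 'D_d orbit q.
Let response (q : ext) : 'cV[R]_N := 'D_(0, 1, 0, 0) flow_map (start q).
Let pairing (q : ext) : R := bilin (Omega a (orbit q)) (tangent q) (response q).
(* The derivative of the Hamiltonian with respect to the parameter. *)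
Let dH (q : ext) : R := 'D_(1, 0, 0) HH (state q).

Let J_open : open J.
Proof.
apply: (torus_times_open U_open H_periodic phi_flow (C1_open flow_C1)) => // q.
exact: (C1_continuous K_C1).
Qed.

Let JJ_open : open JJ.
Proof. by apply: open_comp => // q _; exact: cvg_fst. Qed.

Let C1_start : C1 JJ start.
Proof.
have idJ : C1 JJ (fun q => q) by exact: C1_id.
have thphJ : C1 JJ (fun q => q.2) by exact: C1_snd.
apply: C1_pair; last exact: C1_snd.
apply: C1_pair; last exact: (C1_comp thphJ K_C1 (fun _ _ => I)).
by apply: C1_pair; [exact: C1_fst|exact: C1_cst].
Qed.

Let start_dom q : JJ q -> dom (start q). Proof. by case: q => t [th ph]; exact. Qed.

Let C1_orbit : C1 JJ orbit. Proof. exact: (C1_comp C1_start flow_C1 start_dom). Qed.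

Let orbit_U q : JJ q -> U (orbit q).
Proof. by move=> /start_dom/(flow_deriv phi_flow)[]. Qed.

Let orbit_deriv t x : J t ->
  is_derive t 1 (fun t => orbit (t, x)) (XX (state (t, x))).
Proof. by move=> Jt; have [_] := flow_deriv phi_flow (@start_dom (t, x) Jt). Qed.

Let C1_state : C1 JJ state.
Proof.
have idJ : C1 JJ (fun q => q) by exact: C1_id.
apply: C1_pair; first by apply: C1_pair; [exact: C1_cst|exact: C1_orbit].
apply: C1_add; first by apply: C1_snd; exact: C1_snd.
by apply: C1_scale; exact: C1_fst.
Qed.

Let state_A q : JJ q -> A (state q). Proof. exact: orbit_U. Qed.

Let line_deriv (q : ext) (s : R) : is_derive s 1 (fun s : R => q + s *: d) d.
Proof. exact: is_derive_line. Qed.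

(** The family of orbits obtained by moving along [d] solves one nonautonomous
    equation with a fixed parameter, hence the zero first component. *)
Let tangent_deriv t x : J t ->
  is_derive t 1 (fun t => tangent (t, x)) ('D_(0, tangent (t, x), 0) XX (state (t, x))).
Proof.
move=> Jt; case: x => th ph.
pose L (q : R * R) : ext := (q.1, (th, ph)) + q.2 *: d.
have L_C1 : C1 setT L.
  have idT : C1 [set: R * R] (fun q => q) by apply: C1_id; exact: openT.
  apply: C1_add; last by apply: C1_scale; exact: C1_snd.
  by apply: C1_pair; [exact: C1_fst|apply: C1_cst; exact: openT].
pose O := [set q | JJ (L q)].
have O_open : open O.
  by apply: open_comp => // q _; exact: (C1_continuous L_C1).
have LO : C1 O L by apply: C1_sub L_C1.
have Y_C1 : C1 O (fun q => orbit (L q)) by exact: (C1_comp LO C1_orbit (fun _ => id)).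
have L0 t' : L (t', 0) = (t', (th, ph)) by rewrite /L scale0r addr0.
have dL t' s : 'D_(0, 1) L (t', s) = d.
  have [_ <-] := is_derive_comp (is_derive_pair (is_derive_cst (t' : R) s 1)
    (is_derive_id s 1)) (C1_diff L_C1 (I : setT (t', s))).
  by have [_ ->] := line_deriv (t', (th, ph)) s.
have dY t' : J t' -> 'D_(0, 1) (fun q => orbit (L q)) (t', 0) = tangent (t', (th, ph)).
  move=> Jt'; rewrite (derive_comp _ (C1_diff L_C1 (I : setT (t', 0)))); last first.
    by rewrite L0; exact: (C1_diff C1_orbit).
  by rewrite dL L0.
have Y_ode (q : R * R) : O q -> is_derive (q.1 : R) 1 (fun t => orbit (L (t, q.2)))
    (XX (eps, orbit (L q), ph + q.1 *: alphahat)).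
  case: q => t' s Oq.
  (* The time is shifted by [s * c] and the phase by the opposite amount. *)
  have LE t'' : L (t'', s) = (t'' + s * c, (th + s *: u, ph - s *: (c *: alphahat))).
    by rewrite -scalerN.
  have dZ := orbit_deriv (th + s *: u, ph - s *: (c *: alphahat)) (Oq : J (t' + s * c)).
  have -> : (fun t => orbit (L (t, s))) =
      (fun t => orbit (t + s * c, (th + s *: u, ph - s *: (c *: alphahat)))).
    by apply/funext => t''; rewrite LE.
  apply: is_derive_eq (is_derive_translate dZ) _.
  congr XX; rewrite LE /state /=; congr (_, _).
  by rewrite scalerDl scalerA [t' *: _ + _]addrC addrA subrK.
have cp : continuous (fun t : R => ph + t *: alphahat) by exact: continuous_line.
have dc (s : R) : is_derive s 1 (fun=> eps : R) 0 := is_derive_cst _ _ _.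
have O0 : O (t, 0) by rewrite /O /= L0.
have var := variational_equation (C1_hamiltonian_field U_open a'U Omega_inv HA H'A)
  Y_C1 cp dc O0 (fun q Oq => orbit_U Oq) Y_ode.
have E : (eps, orbit (L (t, 0)), ph + t *: alphahat) = state (t, (th, ph)) by rewrite L0.
have near_dY : \forall t' \near t,
    'D_(0, 1) (fun q => orbit (L q)) (t', 0) = tangent (t', (th, ph)).
  have : \forall t' \near t, J t' by exact: open_nbhs_nbhs.
  by apply: filterS => t' Jt'; exact: dY.
apply: is_derive_eq (near_eq_is_derive near_dY var) _.
exact: (f_equal2 (fun e p => 'D_(0, e, 0) XX p) (dY t Jt) E).
Qed.

(** Here the family is indexed by the parameter itself, hence the first component
    1 in the direction. *)
Let response_deriv t x : J t ->
  is_derive t 1 (fun t => response (t, x)) ('D_(1, response (t, x), 0) XX (state (t, x))).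
Proof.
move=> Jt; case: x => th ph.
pose L (q : R * R) := (q.1, q.2, K th ph, ph).
have L_C1 : C1 setT L.
  have idT : C1 [set: R * R] (fun q => q) by apply: C1_id; exact: openT.
  apply: C1_pair; last by apply: C1_cst; exact: openT.
  apply: C1_pair; last by apply: C1_cst; exact: openT.
  by apply: C1_pair; [exact: C1_fst|exact: C1_snd].
pose O := [set q | dom (L q)].
have O_open : open O.
  apply: open_comp; last exact: (C1_open flow_C1).
  by move=> q _; exact: (C1_continuous L_C1).
have LO : C1 O L by apply: C1_sub L_C1.
have Y_C1 : C1 O (fun q => flow_map (L q)) by exact: (C1_comp LO flow_C1 (fun _ => id)).
have dL t' s : 'D_(0, 1) L (t', s) = (0, 1, 0, 0).
  have [_ <-] := is_derive_comp (is_derive_pair (is_derive_cst (t' : R) s 1)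
    (is_derive_id s 1)) (C1_diff L_C1 (I : setT (t', s))).
  by have [_ ->] := is_derive_pair (is_derive_pair (is_derive_pair
    (is_derive_cst (t' : R) s 1) (is_derive_id s 1)) (is_derive_cst (K th ph) s 1))
    (is_derive_cst ph s 1).
have dY t' : J t' -> 'D_(0, 1) (fun q => flow_map (L q)) (t', eps) = response (t', (th, ph)).
  move=> Jt'; rewrite (derive_comp _ (C1_diff L_C1 (I : setT (t', eps)))).
    by rewrite dL.
  by apply: (C1_diff flow_C1); exact: Jt'.
have Y_sol (q : R * R) : O q -> U (flow_map (L q)) /\
    is_derive (q.1 : R) 1 (fun t => flow_map (L (t, q.2)))
    (XX (q.2, flow_map (L q), ph + q.1 *: alphahat)).
  by move=> Oq; exact: (flow_deriv phi_flow Oq).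
have cp : continuous (fun t : R => ph + t *: alphahat) by exact: continuous_line.
have dc (s : R) : is_derive s 1 (fun e : R => e) 1 := is_derive_id _ _.
have O0 : O (t, eps) by exact: Jt.
have var := variational_equation (C1_hamiltonian_field U_open a'U Omega_inv HA H'A)
  Y_C1 cp dc O0 (fun q Oq => (Y_sol q Oq).1) (fun q Oq => (Y_sol q Oq).2).
have near_dY : \forall t' \near t,
    'D_(0, 1) (fun q => flow_map (L q)) (t', eps) = response (t', (th, ph)).
  have : \forall t' \near t, J t' by exact: open_nbhs_nbhs.
  by apply: filterS => t' Jt'; exact: dY.
apply: is_derive_eq (near_eq_is_derive near_dY var) _.
exact: (f_equal (fun e => 'D_(1, e, 0) XX (state (t, (th, ph)))) (dY t Jt)).
Qed.

(** The phase component vanishes by the choice of [d]. *)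
Let derive_state q : JJ q -> 'D_d state q = (0, tangent q, 0).
Proof.
move=> Jq; have dZ := C1_deriveP d C1_orbit Jq.
have dq := is_derive_id q d.
have dph := is_derive_snd (is_derive_snd dq).
have dt : is_derive q d (fun q : ext => q.1 *: alphahat) (c *: alphahat).
  have [ds dE] : is_diff (q.1 : R) (fun s : R => s *: alphahat) (fun s => s *: alphahat).
    exact: is_diff_scalel.
  by apply: is_derive_eq (is_derive_comp (is_derive_fst dq) ds) _; rewrite deriveE// dE.
have [_ ->] := is_derive_pair (is_derive_pair (is_derive_cst (eps : R) q d) dZ) (is_deriveD dph dt).
by rewrite /d /= addNr.
Qed.

Let C1_dH : C1 JJ dH. Proof. exact: (C1_comp C1_state (H'A (1, 0, 0)) state_A). Qed.

Let pairing_deriv t x : J t -> is_derive t 1 (fun t => pairing (t, x)) ('D_d dH (t, x)).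
Proof.
move=> Jt; have Jq : JJ (t, x) by [].
have dO := is_derive_comp (orbit_deriv x Jt) (C1_diff (C1_Omega U_open a'U) (orbit_U Jq)).
apply: is_derive_eq (is_derive_bilin dO (tangent_deriv x Jt) (response_deriv x Jt)) _.
rewrite (symplectic_rate U_open aU a'U Omega_inv HA H'A _ _ (state_A Jq)).
by rewrite (derive_comp _ (C1_diff C1_state Jq) (C1_diff (H'A (1, 0, 0)) (state_A Jq))) derive_state.
Qed.

Let pairing_continuous q : JJ q -> {for q, continuous pairing}.
Proof.
move=> Jq.
have cO : {for q, continuous (fun q => Omega a (orbit q))}.
  exact: (continuous_at_comp (C1_continuous C1_orbit Jq) (C1_continuous (C1_Omega U_open a'U) (orbit_U Jq))).
have cw : {for q, continuous tangent} by exact: C1_derive_dir_continuous C1_orbit Jq.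
have cv : {for q, continuous response}.
  have ce : {for q, continuous (fun=> (0, 1, 0, 0) : R * R * 'cV[R]_N * 'cV[R]_l)}.
    exact: continuous_at_cst.
  exact: (C1_derive_continuous_comp flow_C1 (start_dom Jq) (C1_continuous C1_start Jq) ce).
apply: continuous_at_sum => i; apply: continuous_at_sum => j.
apply: cvgM; last exact: (@continuous_at_entry _ _ _ _ response q j 0 cv).
apply: cvgM; first exact: (@continuous_at_entry _ _ _ _ tangent q i 0 cw).
exact: (@continuous_at_entry _ _ _ _ (fun q => Omega a (orbit q)) q i j cO).
Qed.

Let slice_continuous (F : ext -> R) t : (forall q, JJ q -> {for q, continuous F}) ->
  J t -> continuous (fun x : 'cV[R]_m * 'cV[R]_l => F (t, (x.1, x.2))).
Proof.
move=> cF Jt [th ph]; apply: (@continuous_at_comp _ _ _ (fun x => (t, (x.1, x.2))) F); last exact: cF.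
apply: continuous_at_pair; first exact: continuous_at_cst.
by apply: continuous_at_pair; [apply: continuous_at_fst|apply: continuous_at_snd]; exact: continuous_at_id.
Qed.

Let mean_pairing (t : R) : R := mean (fun th ph => pairing (t, (th, ph))).
Let mean_dH (t : R) : R := mean (fun th ph => dH (t, (th, ph))).
Let rate (t : R) : R := mean (fun th ph => 'D_d dH (t, (th, ph))).

Let dH_continuous q : JJ q -> {for q, continuous dH}.
Proof. exact: (C1_continuous C1_dH). Qed.

Let ddH_continuous q : JJ q -> {for q, continuous (fun q => 'D_d dH q)}.
Proof. exact: (C1_derive_dir_continuous C1_dH). Qed.

Let mean_pairing_deriv t : J t -> is_derive t 1 mean_pairing (rate t).
Proof.
move=> Jt; apply: (@mean_derive _ _ _ J (fun t th ph => pairing (t, (th, ph)))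
  (fun t th ph => 'D_d dH (t, (th, ph))) t J_open Jt).
- by move=> s Js; exact: slice_continuous pairing_continuous Js.
- move=> s th ph Js.
  apply: (@continuous_at_comp _ _ _ (fun p : ext => (p.1, (p.2.1, p.2.2))) (fun q => 'D_d dH q)).
    apply: continuous_at_pair; first exact: (continuous_at_fst (continuous_at_id _)).
    by apply: continuous_at_pair; [apply: continuous_at_fst|apply: continuous_at_snd]; exact: (continuous_at_snd (continuous_at_id _)).
  exact: ddH_continuous.
- by move=> s th ph; exact: pairing_deriv.
Qed.

Let dH_periodic_theta t ph : Zperiodic (fun th => dH (t, (th, ph))).
Proof. by move=> th k; rewrite /dH /state /orbit /= K_periodic_theta. Qed.

Let dH_periodic_phi t th : J t -> Zperiodic (fun ph => dH (t, (th, ph))).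
Proof.
move=> Jt ph k.
have Uz := orbit_U (Jt : JJ (t, (th, ph))).
have ZE : orbit (t, (th, ph + map_mx intr k)) = orbit (t, (th, ph)).
  rewrite /orbit /= K_periodic_phi.
  by have [] := flow_periodic U_open H_periodic phi_flow k (Jt th ph).
have stateE : state (t, (th, ph + map_mx intr k)) =
    (eps, orbit (t, (th, ph)), ph + t *: alphahat + map_mx intr k).
  by rewrite /state /= ZE addrAC.
rewrite /dH stateE.
have slice y : 'D_(1, 0, 0) HH (eps, orbit (t, (th, ph)), y) =
    'D_1 (fun e => H e (orbit (t, (th, ph))) y) eps.
  have dd := is_derive_pair (is_derive_pair (is_derive_id (eps : R) 1)
    (is_derive_cst (orbit (t, (th, ph))) (eps : R) 1)) (is_derive_cst y (eps : R) 1).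
  by have [_ <-] := is_derive_comp dd (C1_diff HA (Uz : A (eps, orbit (t, (th, ph)), y))).
rewrite !slice; congr ('D_1 _ eps); apply/funext => e.
exact: H_periodic.
Qed.

Let mean_dH_translate t s : J (t + s * c) ->
  mean (fun th ph => dH ((t, (th, ph)) + s *: d)) = mean_dH (t + s * c).
Proof.
move=> Jt.
exact: (@mean_translate _ _ _ (fun th ph => dH (t + s * c, (th, ph))) (s *: u)
  (s *: - (c *: alphahat)) (slice_continuous dH_continuous Jt)
  (dH_periodic_theta _) (fun th => dH_periodic_phi th Jt)).
Qed.

(** The average of the derivative along [d] is the derivative of the average in
    time alone, since the translations in the angles do not change the average. *)
Let mean_dH_deriv t : J t -> is_derive (0 : R) 1 (fun s : R => mean_dH (t + s * c)) (rate t).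
Proof.
move=> Jt; pose Jc := [set s : R | J (t + s * c)].
have Jc_open : open Jc.
  apply: open_comp => // s _; apply: cvgD; first exact: cvg_cst.
  by apply: cvgM; [exact: cvg_id|exact: cvg_cst].
have Jc0 : Jc 0 by rewrite /Jc /= mul0r addr0.
have cshift (s : R) (th : 'cV[R]_m) (ph : 'cV[R]_l) : {for (s, (th, ph)),
    continuous (fun p : ext => (t, (p.2.1, p.2.2)) + p.1 *: d)}.
  apply: cvgD; last by apply: cvgZr_tmp; exact: (continuous_at_fst (continuous_at_id _)).
  apply: continuous_at_pair; first exact: continuous_at_cst.
  by apply: continuous_at_pair; [apply: continuous_at_fst|apply: continuous_at_snd]; exact: (continuous_at_snd (continuous_at_id _)).
have Jshift s th ph : Jc s -> JJ ((t, (th, ph)) + s *: d) by [].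
have near_mean : \forall s \near (0 : R),
    mean (fun th ph => dH ((t, (th, ph)) + s *: d)) = mean_dH (t + s * c).
  have : \forall s \near (0 : R), Jc s by exact: open_nbhs_nbhs.
  by apply: filterS => s Js; exact: mean_dH_translate.
apply: near_eq_is_derive near_mean _.
have -> : rate t = mean (fun th ph => 'D_d dH ((t, (th, ph)) + 0 *: d)).
  apply: (f_equal mean); apply/funext => th; apply/funext => ph.
  by apply: (f_equal ('D_d dH)); rewrite scale0r addr0.
apply: (@mean_derive _ _ _ Jc (fun s th ph => dH ((t, (th, ph)) + s *: d))
  (fun s th ph => 'D_d dH ((t, (th, ph)) + s *: d)) 0 Jc_open Jc0).
- move=> s Js [th ph]; apply: (@continuous_at_comp _ _ _
    (fun x : 'cV[R]_m * 'cV[R]_l => (t, (x.1, x.2)) + s *: d) dH).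
    apply: (@continuous_at_comp _ _ _ (fun x : 'cV[R]_m * 'cV[R]_l => (s, x))
      (fun p : ext => (t, (p.2.1, p.2.2)) + p.1 *: d)); last exact: cshift.
    by apply: continuous_at_pair; [exact: continuous_at_cst|exact: continuous_at_id].
  exact: (dH_continuous (Jshift s th ph Js)).
- move=> s th ph Js; apply: (@continuous_at_comp _ _ _
    (fun p : ext => (t, (p.2.1, p.2.2)) + p.1 *: d) (fun q => 'D_d dH q)).
    exact: cshift.
  exact: (ddH_continuous (Jshift s th ph Js)).
- move=> s th ph Js.
  exact: (is_derive_comp (line_deriv (t, (th, ph)) s) (C1_diff C1_dH (Jshift s th ph Js))).
Qed.

Let J_segment t : 0 <= t <= T -> J t.
Proof. by move=> tT th ph; exact: (flow_interval phi_flow (phi_defined th ph) tT). Qed.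

(** At time [T] the orbits are back on the torus, at translated angles. *)
Let mean_dH_end : mean_dH T = mean_dH 0.
Proof.
rewrite [RHS](_ : _ = mean (fun th ph => dH (0, (th + omega, ph + T *: alphahat)))).
  congr mean; apply/funext => th; apply/funext => ph; congr ('D_(1, 0, 0) HH _).
  rewrite /state /orbit /= K_invariant scale0r addr0.
  by have [_ ->] := flow0 phi_flow eps (ph + T *: alphahat) (K_in_U (th + omega) (ph + T *: alphahat)).
have J0 : J 0 by apply: J_segment; rewrite lexx.
rewrite (@mean_translate _ _ _ (fun th ph => dH (0, (th, ph))))//.
- exact: slice_continuous dH_continuous J0.
- by move=> th; exact: dH_periodic_phi.
Qed.

(** At time 0 the flow is the identity for all values of the parameter, so the
    response vanishes. *)
Let mean_pairing_start : mean_pairing 0 = 0.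
Proof.
have v0 x : response (0, x) = 0.
  case: x => th ph.
  have dd := is_derive_pair (is_derive_pair (is_derive_pair (is_derive_cst (0 : R) (eps : R) 1)
    (is_derive_id (eps : R) 1)) (is_derive_cst (K th ph) (eps : R) 1)) (is_derive_cst ph (eps : R) 1).
  have P0 : dom (start (0, (th, ph))) by have [] := flow0 phi_flow eps ph (K_in_U th ph).
  have [_ E] := is_derive_comp dd (C1_diff flow_C1 P0).
  apply: (etrans (esym E)).
  have -> : (fun e : R => flow_map (0, e, K th ph, ph)) = cst (K th ph).
    by apply/funext => e; have [_] := flow0 phi_flow e ph (K_in_U th ph).
  exact: derive_cst.
have pairing0 : (fun th ph => pairing (0, (th, ph))) = (fun (th : 'cV[R]_m) (ph : 'cV[R]_l) => 0 : R).
  apply/funext => th; apply/funext => ph; rewrite /pairing v0.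
  by apply: big1 => i _; apply: big1 => j _; rewrite [X in _ * X]mxE mulr0.
apply/eqP; rewrite -normr_le0 /mean_pairing pairing0; apply: mean_norm_le.
  by move=> q; exact: cvg_cst.
by move=> th ph _ _; rewrite normr0.
Qed.

Lemma mean_symplectic_rate : c = 0 \/ c = 1 -> mean_pairing T = 0.
Proof.
have constant (f : R -> R) : (forall t, J t -> is_derive t 1 f 0) -> f T = f 0.
  move=> df.
  have df' t : t \in `]0, T[ -> is_derive t 1 f 0.
    by rewrite in_itv/= => /andP[t0 tT]; apply: df; apply: J_segment; rewrite !ltW.
  have cf : {within `[0, T], continuous f}.
    apply: derivable_within_continuous => t; rewrite in_itv/= => tT.
    by have [] := df t (J_segment tT).
  have [t _] := MVT_segment T_ge0 df' cf.
  by rewrite mul0r => /eqP; rewrite subr_eq0 => /eqP.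
case=> c01.
  apply: (etrans (constant mean_pairing _) mean_pairing_start) => t Jt.
  apply: is_derive_eq (mean_pairing_deriv Jt) _.
  have [_ <-] := mean_dH_deriv Jt.
  rewrite (_ : (fun s => _) = cst (mean_dH t)) ?derive_cst//.
  by apply/funext => s; rewrite c01 mulr0 addr0.
have : mean_pairing T - mean_dH T = mean_pairing 0 - mean_dH 0.
  apply: (constant (fun t => mean_pairing t - mean_dH t)) => t Jt.
  rewrite -(subrr (rate t)); apply: is_deriveB (mean_pairing_deriv Jt) _.
  have := mean_dH_deriv Jt; rewrite -{1}(subrr t) => /is_derive_translate.
  by congr (is_derive _ _ _ _); apply/funext => s; rewrite c01 mulr1 addrC subrK.
by rewrite mean_dH_end mean_pairing_start sub0r => /eqP; rewrite subr_eq addNr => /eqP.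
Qed.

Let shift_deriv (x y : 'cV[R]_m * 'cV[R]_l) :
  is_derive x y (fun x => (x.1 + omega, x.2 + T *: alphahat)) y.
Proof.
have dx := is_derive_id x y.
have dd := is_derive_pair (is_deriveD (is_derive_fst dx) (is_derive_cst omega x y))
  (is_deriveD (is_derive_snd dx) (is_derive_cst (T *: alphahat) x y)).
by apply: is_derive_eq dd _; rewrite !addr0 -surjective_pairing.
Qed.

(** The direction [d] is split into its time component, which gives the field, and
    its angular component, along which the time-[T] map is given by [K]. *)
Let tangent_end th ph : tangent (T, (th, ph)) =
  c *: hamiltonian_field a H eps (K (th + omega) (ph + T *: alphahat)) (ph + T *: alphahat) +
  'D_(u, - (c *: alphahat)) (fun q => K q.1 q.2) (th + omega, ph + T *: alphahat).
Proof.
have JT : J T by move=> th' ph'; exact: phi_defined.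
have dZ : differentiable orbit (T, (th, ph)) by apply: (C1_diff C1_orbit); exact: JT.
have dE : d = c *: (1, (0, 0)) + (0, (u, - (c *: alphahat))).
  apply: (f_equal2 pair); rewrite /= ?addr0 ?mulr1// /GRing.scale /= ?mulr1//.
  by apply: (f_equal2 pair); rewrite /= scaler0 add0r.
apply: (etrans (f_equal (fun d => 'D_d orbit (T, (th, ph))) dE)).
apply: (etrans (deriveDvec _ _ dZ)); apply: (f_equal2 +%R).
  apply: (etrans (deriveZvec _ _ dZ)); apply: (f_equal ( *:%R c)).
  have [_ E] := is_derive_comp (is_derive_pair (is_derive_id (T : R) 1)
    (is_derive_cst (th, ph) (T : R) 1)) dZ.
  apply: (etrans (esym E)); have [_ ->] := orbit_deriv (th, ph) JT.
  by rewrite /XX /state /orbit /= K_invariant.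
set y := (u, - (c *: alphahat)).
have [_ E] := is_derive_comp (is_derive_pair (is_derive_cst (T : R) (th, ph) y)
  (is_derive_id (th, ph) y)) dZ.
apply: (etrans (esym E)).
have dK : differentiable (fun q => K q.1 q.2) (th + omega, ph + T *: alphahat).
  exact: (C1_diff K_C1 I).
have [_ <-] := is_derive_comp (shift_deriv (th, ph) y) dK.
apply: (f_equal (fun f => 'D_y f (th, ph))); apply/funext => -[th' ph'].
exact: K_invariant.
Qed.

Let response_end th ph : response (T, (th, ph)) = deps phi T eps (K th ph) ph.
Proof.
rewrite /deps derive1E.
have dd := is_derive_pair (is_derive_pair (is_derive_pair (is_derive_cst (T : R) (eps : R) 1)
  (is_derive_id (eps : R) 1)) (is_derive_cst (K th ph) (eps : R) 1)) (is_derive_cst ph (eps : R) 1).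
have [_ E] := is_derive_comp dd (C1_diff flow_C1 (phi_defined th ph)).
exact: esym E.
Qed.

Lemma mean_invariant_torus : c = 0 \/ c = 1 ->
  mean (fun th ph =>
    let thbar := th + omega in let phbar := ph + T *: alphahat in
    - bilin (Omega a (K thbar phbar))
      (c *: hamiltonian_field a H eps (K thbar phbar) phbar +
       'D_(u, - (c *: alphahat)) (fun q => K q.1 q.2) (thbar, phbar))
      (deps phi T eps (K th ph) ph)) = 0.
Proof.
move=> /mean_symplectic_rate pairing0.
have JT : J T by move=> th ph; exact: phi_defined.
have QN := @mean_opp _ _ _ (fun th ph => pairing (T, (th, ph))) (slice_continuous pairing_continuous JT).
transitivity (mean (fun th ph => - pairing (T, (th, ph)))); last by rewrite QN -/(mean_pairing T) pairing0 oppr0.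
apply: (f_equal mean); apply/funext => th; apply/funext => ph; apply: (f_equal -%R).
by rewrite /pairing tangent_end response_end /orbit /= K_invariant.
Qed.

End Average.

Lemma mulmx_jac {R : realType} {p q : nat} (f : 'cV[R]_p -> 'cV[R]_q)
    (x v : 'cV[R]_p) : differentiable f x -> jac f x *m v = 'D_v f x.
Proof.
move=> df; apply/colP => i; rewrite [in RHS](cV_sum_delta v) derive_sumvec// summxE mxE.
by apply: eq_bigr => j _; rewrite !mxE mulrC.
Qed.

Lemma derive_partial {R : realType} {V W X : normedModType R} (f : V -> W -> X)
    (x v : V) (y w : W) : differentiable (fun q => f q.1 q.2) (x, y) ->
  'D_v (fun x => f x y) x = 'D_(v, 0) (fun q => f q.1 q.2) (x, y) /\
  'D_w (f x) y = 'D_(0, w) (fun q => f q.1 q.2) (x, y).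
Proof.
move=> df; split.
  by have [_] := is_derive_comp (is_derive_pair (is_derive_id x v) (is_derive_cst y x v)) df.
by have [_] := is_derive_comp (is_derive_pair (is_derive_cst x y w) (is_derive_id y w)) df.
Qed.

Theorem lemmaF1 (R : realType) (n d l : nat)
    (d_gt0 : (0 < d)%N) (dn : d = (n - 1)%N)
    (U : set 'cV[R]_(2 * n)) (U_open : open U)
    (a : 'cV[R]_(2 * n) -> 'cV[R]_(2 * n)) (a_smooth : Ck_on 2 U a)
    (Omega_inv : forall z, U z -> Omega a z \in unitmx)
    (alphahat : 'cV[R]_l)
    (H : R -> 'cV[R]_(2 * n) -> 'cV[R]_l -> R)
    (H_periodic : forall e z, U z -> Zperiodic (H e z))
    (H_smooth : Ck_on 2 [set p : R * 'cV[R]_(2 * n) * 'cV[R]_l | U p.1.2]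
                  (fun p => H p.1.1 p.1.2 p.2))
    (H_analytic : forall z ph, U z -> analytic (fun e => H e z ph))
    (dom : set (R * R * 'cV[R]_(2 * n) * 'cV[R]_l))
    (phi : R -> R -> 'cV[R]_(2 * n) -> 'cV[R]_l -> 'cV[R]_(2 * n))
    (phi_flow : is_flow U a H alphahat dom phi)
    (phi_smooth : Ck_on 1 dom (fun p => phi p.1.1.1 p.1.1.2 p.1.2 p.2))
    (T : R) (T_gt0 : 0 < T) (omega : 'cV[R]_(d - 1))
    (eps : R)
    (K : 'cV[R]_(d - 1) -> 'cV[R]_l -> 'cV[R]_(2 * n))
    (K_periodic_theta : forall ph, Zperiodic (fun theta => K theta ph))
    (K_periodic_phi : forall theta, Zperiodic (K theta))
    (K_smooth : Ck_on 1 [set: 'cV[R]_(d - 1) * 'cV[R]_l]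
                  (fun p => K p.1 p.2))
    (K_in_U : forall theta ph, U (K theta ph))
    (phi_defined : forall theta ph, dom (T, eps, K theta ph, ph))
    (K_invariant : forall theta ph,
        phi T eps (K theta ph) ph = K (theta + omega) (ph + T *: alphahat)) :
  average (eta31 a phi T eps omega alphahat K) = 0 /\
  average (eta32 a H phi T eps omega alphahat K) = 0.
Proof.
have U_C1 : C1 U a by apply: Ck2_C1 a_smooth.2 => //; exact: finite_frame_cV.
have U_C2 v : C1 U (fun y => 'D_v a y).
  by apply: Ck2_C1_derive a_smooth.2 => //; exact: finite_frame_cV.
have [A_open H_C2] := H_smooth.
have phase_frame : finite_frame (R * 'cV[R]_(2 * n) * 'cV[R]_l)%type.
  apply: finite_frame_pair; last exact: finite_frame_cV.
  by apply: finite_frame_pair; [exact: finite_frame_scalar|exact: finite_frame_cV].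
have HA := Ck2_C1 phase_frame A_open H_C2.
have H'A v := Ck2_C1_derive v phase_frame A_open H_C2.
have flow_frame : finite_frame (R * R * 'cV[R]_(2 * n) * 'cV[R]_l)%type.
  apply: finite_frame_pair; last exact: finite_frame_cV.
  apply: finite_frame_pair; last exact: finite_frame_cV.
  by apply: finite_frame_pair; exact: finite_frame_scalar.
have phi_C1 := Ck1_C1 flow_frame phi_smooth.1 phi_smooth.2.
have K_C1 := Ck1_C1 (finite_frame_pair (finite_frame_cV _) (finite_frame_cV _))
  K_smooth.1 K_smooth.2.
have zero_mean := mean_invariant_torus U_open U_C1 U_C2 Omega_inv H_periodic HA H'A
  phi_flow phi_C1 (ltW T_gt0) K_periodic_theta K_periodic_phi K_C1 K_in_U phi_defined
  K_invariant.
have dK th ph : differentiable (fun q => K q.1 q.2) (th, ph) := C1_diff K_C1 I.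
have dK1 th ph : differentiable (fun th => K th ph) th.
  by apply: (@differentiable_comp _ _ _ _ (fun th => (th, ph)) (fun q => K q.1 q.2)).
have dK2 th ph : differentiable (K th) ph.
  by apply: (@differentiable_comp _ _ _ _ (fun ph => (th, ph)) (fun q => K q.1 q.2)).
split; apply/colP => i; rewrite !mxE.
  (* With [c = 0], the tangent vector is a column of the Jacobian in theta. *)
  apply: (etrans _ (zero_mean 0 (delta_mx i 0) (or_introl erefl))).
  apply: (f_equal mean); apply/funext => th; apply/funext => ph /=.
  rewrite /eta31 /= mxE; apply: (f_equal -%R).
  rewrite scale0r add0r scale0r oppr0.
  rewrite -(derive_partial (delta_mx i 0) 0 (dK _ _)).1 -mulmx_jac//.
  by rewrite bilinE trmx_mul trmx_delta -!mulmxA -rowE [RHS]mxE.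
(* With [c = 1] and [u = 0], the tangent vector is the torus field. *)
apply: (etrans _ (zero_mean 1 0 (or_intror erefl))).
apply: (f_equal mean); apply/funext => th; apply/funext => ph /=.
rewrite /eta32 /= mxE bilinE ord1; apply: (f_equal -%R).
have -> // : torus_field a H eps alphahat K (th + omega) (ph + T *: alphahat) =
  1 *: hamiltonian_field a H eps (K (th + omega) (ph + T *: alphahat)) (ph + T *: alphahat) +
  'D_(0, - (1 *: alphahat)) (fun q => K q.1 q.2) (th + omega, ph + T *: alphahat).
rewrite /torus_field !scale1r; apply: (f_equal (fun x => _ + x)).
by rewrite -(derive_partial 0 (- alphahat) (dK _ _)).2 -mulmx_jac// mulmxN.
Qed.
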